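(* Let $2\le n\le 6$. Let $\bm{U}_n=(U_n(1),\ldots,U_n(n-1))$ be the vector of last swap times of the oriented swap process on $n$ particles, and let $\bm{V}_n=(V_n(1),\ldots,V_n(n-1))$ be the vector of addition times of the boxes $(n-k,k)$, $1\le k\le n-1$, in the random growth of the staircase Young diagram $\delta_n=(n-1,n-2,\ldots,1)$ (both defined in the context). Then $\bm{U}_n$ and $\bm{V}_n$ have the same distribution.
   Context: Oriented swap process: at time $0$ the particle labelled $j$ sits at position $j$ of $\{1,\ldots,n\}$, for $j=1,\ldots,n$. Each pair of adjacent positions $k,k+1$ ($1\le k\le n-1$) carries an independent Poisson clock of rate $1$. When the clock of $(k,k+1)$ rings, if the particles at positions $k,k+1$ have labels $i,j$ with $i<j$ they swap; otherwise nothing happens. $U_n(k)$ is the last time at which a swap occurs between positions $k$ and $k+1$. Staircase growth: boxes are identified with $(i,j)\in\mathbb{N}^2$ ($i$ = row, $j$ = column). Starting from the empty Young diagram, each box $(i,j)\in\delta_n$ carries an independent Poisson clock of rate $1$; when it rings, the box is added to the current diagram $\lambda$ if and only if $(i,j)\notin\lambda$ and $\lambda\cup\{(i,j)\}$ is a Young diagram. The process ends when $\delta_n$ is formed. $V_n(k)$ is the time at which the box $(n-k,k)$ is added. (Equivalently, $V_n(k)=L(1,1;n-k,k)$, the last passage time with i.i.d. rate-$1$ exponential weights.) *)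

(* Defs.v *)
From HB Require Import structures.
From mathcomp Require Import all_boot all_order all_algebra all_fingroup.
From mathcomp Require Import finmap.
From mathcomp Require Import all_classical all_reals all_analysis.

Set Implicit Arguments.
Unset Strict Implicit.
Unset Printing Implicit Defensive.

Import Order.TTheory GRing.Theory Num.Theory.

Local Open Scope classical_set_scope.
Local Open Scope ring_scope.

Section probability_notions.
Context {R : realType}.

Definition mutually_independent d (T : measurableType d) (P : probability T R)
    (I : choiceType) (X : I -> {RV P >-> R}) :=
  forall (J : {fset I}) (A : I -> set R), (forall i, measurable (A i)) ->
    P (\bigcap_(i in [set` J]) (X i @^-1` A i)) =
    (\prod_(i <- J) P (X i @^-1` A i))%E.

(* A Poisson clock of rate 1 rings at the partial sums of i.i.d. Exp(1)
   variables; [gap c m] is the waiting time of clock [c] between its m-th ring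
   (time 0 if [m = 0]) and its (m+1)-th ring. *)
Definition independent_poisson_clocks d (T : measurableType d)
    (P : probability T R) (C : finType) (gap : C -> nat -> {RV P >-> R}) :=
  (forall c m (A : set R), measurable A ->
     distribution P (gap c m) A = exponential_prob 1 A) /\
  mutually_independent (fun e : C * nat => gap e.1 e.2).

(* Measurability is part of the definition because [X] and [Y] are plain
   functions and a probability takes arbitrary values on nonmeasurable sets. *)
Definition same_distribution d1 d2 d (T1 : measurableType d1)
    (T2 : measurableType d2) (E : measurableType d)
    (P1 : probability T1 R) (P2 : probability T2 R)
    (X : T1 -> E) (Y : T2 -> E) :=
  [/\ measurable_fun setT X, measurable_fun setT Y &
      forall A, measurable A -> pushforward P1 X A = pushforward P2 Y A].

End probability_notions.

(* A process with initial state [s0] whose state [s] becomes [step c s] when the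
   clock [c] rings.  Almost surely, ring times are pairwise distinct and finitely
   many of them precede any given time; outside this event the definitions below
   take irrelevant values. *)
Section clock_driven_process.
Context {R : realType} {C : finType} {S : eqType}.
Variables (step : C -> S -> S) (s0 : S) (gap : C -> nat -> R).

Definition ring_time (e : C * nat) : R := \sum_(l < e.2.+1) gap e.1 l.

(* The state just before time [t] (left limit). *)
Definition state_before (t : R) : S :=
  foldl (fun s e => step e.1 s) s0
    (sort (fun e f => ring_time e <= ring_time f)
       (fset_set [set e | ring_time e < t])).

(* The ring times of [c] that have an effect. *)
Definition change_times (c : C) : set R :=
  [set ring_time (c, m) | m in
    [set m | let s := state_before (ring_time (c, m)) in step c s != s]].

Definition last_change_time (c : C) : R := sup (change_times c).

End clock_driven_process.

(* Positions, labels, rows and columns are numbered from 0: the k-th clock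
   (k < n.-1) governs positions k and k.+1, and the state [s : 'S_n] maps each
   position to the label of the particle sitting there. *)
Section oriented_swap_process.
Variable n : nat.

Lemma right_pos_subproof (k : 'I_n.-1) : (k.+1 < n)%N.
Proof. by rewrite -ltn_predRL. Qed.

Definition left_pos (k : 'I_n.-1) : 'I_n := widen_ord (leq_pred n) k.
Definition right_pos (k : 'I_n.-1) : 'I_n := Ordinal (right_pos_subproof k).

(* In the perm library [(s * t) x = t (s x)], so the product below exchanges the
   labels found at the two positions. *)
Definition swap_step (k : 'I_n.-1) (s : 'S_n) : 'S_n :=
  if (s (left_pos k) < s (right_pos k))%N
  then (tperm (left_pos k) (right_pos k) * s)%g else s.

(* The state changes at a ring of [k] iff a swap occurs at positions k, k.+1. *)
Definition last_swap_times {R : realType} (gap : 'I_n.-1 -> nat -> R) :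
    n.-1.-tuple R :=
  [tuple last_change_time swap_step 1%g gap k | k < n.-1].

End oriented_swap_process.

Section staircase_growth.
Variable n : nat.

(* The boxes of the staircase (n-1, n-2, ..., 1), as pairs (row, column). *)
Definition staircase_box : finType :=
  {b : 'I_n.-1 * 'I_n.-1 | (b.1 + b.2 < n.-1)%N}.

Definition is_young_diagram (la : {set staircase_box}) : bool :=
  [forall b in la, forall b' : staircase_box,
    ((val b').1 <= (val b).1)%N && ((val b').2 <= (val b).2)%N ==> (b' \in la)].

Definition growth_step (b : staircase_box) (la : {set staircase_box}) :
    {set staircase_box} :=
  if (b \notin la) && is_young_diagram (b |: la)%SET then (b |: la)%SET else la.

Lemma corner_subproof (k : 'I_n.-1) :
  ((rev_ord k, k).1 + (rev_ord k, k).2 < n.-1)%N.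
Proof. by rewrite /= -[ltnRHS](subnK (ltn_ord k)) ltn_add2l. Qed.

(* With rows and columns numbered from 1, this is the box (n - (k+1), k+1). *)
Definition corner (k : 'I_n.-1) : staircase_box :=
  exist _ (rev_ord k, k) (corner_subproof k).

(* The diagram changes at a ring of [b] iff [b] is added to it, which happens at
   most once, so the last change is the addition of [b]. *)
Definition corner_addition_times {R : realType}
    (gap : staircase_box -> nat -> R) : n.-1.-tuple R :=
  [tuple last_change_time growth_step finset.set0 gap (corner k) | k < n.-1].

End staircase_growth.

(* Main.v *)
(* All last swap times are < t_k iff at each time t_k the chain lies in an
   absorbing set E_k: for the swaps, the k + 1 largest labels fill the first
   k + 1 positions; for the growth, the corner box of k is present.

   The merged ring sequence of N independent clocks has the Poisson law: a given
   word w of rings occupies a given window of width D with probability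
   exp(-ND) D^|w| / |w|!, independently over disjoint windows.  Only "at least"
   has to be proved, since these numbers already add up to 1 over all words; it
   follows from cutting the window into cells with at most one ring each and
   letting the mesh tend to 0.  Hence both joint laws are alternating products
   of exp(D Q), for the generator Q of the chain, and of indicators of the E_k.

   These products agree because the generators are intertwined by a signed
   kernel.  Let pi_i be the operators of adjacent sorting (they generate the
   0-Hecke algebra) and x_i = pi_i - 1, and let kappa(la) be the sum, over the
   diagrams mu contained in la and the tableaux of shape mu with entries
   1, ..., n - 1 increasing along rows and columns, of the monomial in the x_i
   read off the tableau (a noncommutative dual stable Grothendieck polynomial).
   Then kappa(empty) is the identity, kappa(la) has mass 1 and is supported in
   E_k or in its complement according to whether la contains the corner of k, and
   sum_b (kappa(la + b) - kappa(la)) = kappa(la) sum_i (pi_i - 1).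
   For n <= 6 these identities are checked by computation. *)
Require Import Defs.
From Stdlib Require Import ZArith.
From HB Require Import structures.
From mathcomp Require Import all_boot all_order all_algebra all_fingroup.
From mathcomp Require Import finmap.
From mathcomp Require Import all_classical all_reals all_analysis.
From mathcomp Require Import measurable_realfun.
From mathcomp Require Import ssrZ zify ring lra.

Set Implicit Arguments.
Unset Strict Implicit.
Unset Printing Implicit Defensive.

Import Order.TTheory GRing.Theory Num.Theory.
Import numFieldNormedType.Exports.

Local Open Scope classical_set_scope.
Local Open Scope ring_scope.

(** * The signed kernel *)

(** The kernel has negative entries, so it gives no coupling of the two processes and no comparison
    of single trajectories. What survives is linear: a function F of label lists and a function G of
    diagrams are related when G(la) is the integral of F against kappa(la). Generators, indicators
    of the E_k and pointwise limits respect this relation, hence so do the alternating products, and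
    the value of kappa at the empty diagram turns the relation into an equality at the initial
    states.

    Three choices shape the rest. The numbers of clocks differ, n - 1 against n(n - 1)/2, so both
    exponentials are expanded after adding idle clocks up to a common total rate. Times are compared
    strictly, because the state just before t depends exactly on the rings that precede t. For the
    computation, permutations become label lists and diagrams become lists of row lengths; a
    step-by-step simulation ties these back to the processes of the statement. *)

Fixpoint pstep (i : nat) (l : seq nat) : seq nat :=
  match i, l with
  | 0, a :: b :: r => if (a < b)%N then b :: a :: r else l
  | i'.+1, a :: r => a :: pstep i' r
  | _, _ => l
  end.

Definition top_block n k (l : seq nat) := all (leq (n - k.+1)) (take k.+1 l).

Definition boxes n := [seq (i, j) | i <- iota 0 n.-1, j <- iota 0 (n.-1 - i)].

(** [la] is meant to hold all [n.-1] row lengths from the top, empty rows included, so that each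
    diagram has one list. *)
Definition grow (b : nat * nat) (la : seq nat) : seq nat :=
  if (nth 0%N la b.1 == b.2) && ((b.1 == 0%N) || (b.2 < nth 0%N la b.1.-1))%N
  then set_nth 0%N la b.1 b.2.+1 else la.

Fixpoint insert (j x : nat) (l : seq nat) : seq nat :=
  match j, l with
  | j'.+1, a :: r => a :: insert j' x r
  | _, _ => x :: l
  end.

(* Signed measures on the permutations of n labels, as nested tries: slot j of
   a vec m.+1 is the part of the measure where label m sits at position j of
   the permutation of the smaller labels; missing trailing slots are 0.  In this
   form a swap acts on slots as a whole, see nth_vstep. *)
Fixpoint vec (n : nat) : Type := if n is m.+1 then seq (vec m) else Z.

Definition vzero n : vec n := if n is _.+1 then [::] else Z0.

Fixpoint vadd n : vec n -> vec n -> vec n :=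
  match n with
  | 0 => Z.add
  | m.+1 => fix add (u v : seq (vec m)) :=
      match u, v with
      | [::], _ => v
      | _, [::] => u
      | a :: u', b :: v' => vadd a b :: add u' v'
      end
  end.

Fixpoint vopp n : vec n -> vec n :=
  if n is m.+1 then map (@vopp m) else Z.opp.

Definition vsub n (u v : vec n) := vadd u (vopp v).

Fixpoint vnull n : vec n -> bool :=
  if n is m.+1 then all (@vnull m) else Z.eqb Z0.

Fixpoint vunit n : vec n :=
  if n is m.+1 then ncons m (vzero m) [:: vunit m] else Z.one.

Fixpoint all_slots A (f : nat -> A -> bool) j (v : seq A) :=
  if v is a :: v' then f j a && all_slots f j.+1 v' else true.

(** The predicate is asked on the support only: an entry with coefficient 0 passes. *)
Fixpoint vall n : vec n -> pred (seq nat) -> bool :=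
  if n is m.+1 then
    fun v p => all_slots (fun j a => vall a (fun l => p (insert j m l))) 0%N v
  else fun c p => Z.eqb Z0 c || p [::].

(* Multiplication on the right by a generator of index k: slots k and k + 1,
   where it moves the largest label, are combined by comb, the other ones are
   acted on by a generator of index k - 1 (before) or k (after). *)
Fixpoint mul_slots A (zero : A) (comb : A -> A -> A) (before after : A -> A)
    k (v : seq A) :=
  match k, v with
  | _, [::] => [::]
  | k'.+1, a :: v' => before a :: mul_slots zero comb before after k' v'
  | 0, [:: a] => [:: comb a zero]
  | 0, a :: b :: v' => comb a b :: zero :: map after v'
  end.

Fixpoint vmul (comb : forall n, vec n -> vec n -> vec n) n (i : nat) :
    vec n -> vec n :=
  if n is m.+1
  then mul_slots (vzero m) (comb m) (vmul comb i.-1) (vmul comb i) i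
  else id.

Definition vstep := vmul vadd.

(* Right multiplication by x_i in the basis (x_w) of the 0-Hecke algebra, where
   x_i x_i = - x_i. *)
Definition xstep := vmul (fun n a b => vsub b a).

(* The rows of length len with entries in [lo, n - 1[, increasing to the right
   and from each entry to the one below it in the row below. *)
Fixpoint tableau_rows n len lo (below : seq nat) : seq (seq nat) :=
  if len is len'.+1 then
    flatten [seq [seq a :: r | r <- tableau_rows n len' a.+1 (behead below)]
            | a <- iota lo (head n.-1 below - lo)]
  else [:: [::]].

(* mu lists its rows from the bottom up; each is read from left to right. *)
Fixpoint tableau_sum n (mu below : seq nat) (acc : vec n) : vec n :=
  if mu is len :: mu' then
    foldr (fun r s =>
      vadd (tableau_sum mu' r (foldl (fun v i => xstep i v) acc r)) s)
      (vzero n) (tableau_rows n len 0 below)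
  else acc.

(* Expands x_w in the pi basis, using that the permutation with largest label m
   at position j is the product of a permutation of the smaller labels and of
   the generators of index m - 1, ..., j. *)
Fixpoint of_xbasis_slots m (f : vec m -> vec m) j (v : seq (vec m)) :
    vec m.+1 :=
  if v is a :: v' then
    vadd (foldl (fun w i => vsub (vstep i w) w)
            (ncons m (vzero m) [:: f a] : vec m.+1) (rev (iota j (m - j))))
         (of_xbasis_slots f j.+1 v')
  else [::].

Fixpoint of_xbasis n : vec n -> vec n :=
  if n is m.+1 then of_xbasis_slots (@of_xbasis m) 0 else id.

Fixpoint diagrams r w : seq (seq nat) :=
  if r is r'.+1
  then [seq a :: la | a <- iota 0 (minn w r).+1, la <- diagrams r' a]
  else [:: [::]].

Definition staircase_diagrams n := diagrams n.-1 n.-1.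

(** The tableau sum of each shape is computed once in [T]; each kappa(la) is then the sum over the
    shapes inside la. *)
Definition kernel_table n : seq (seq nat * vec n) :=
  let T := [seq (mu, tableau_sum (rev mu) [::] (vunit n))
           | mu <- staircase_diagrams n] in
  [seq (la, of_xbasis
     (foldr (fun p s => if all2 leq p.1 la then vadd p.2 s else s) (vzero n) T))
  | la <- staircase_diagrams n].

Fixpoint lookup n (T : seq (seq nat * vec n)) la : vec n :=
  if T is (mu, v) :: T' then if mu == la then v else lookup T' la else vzero n.

Fixpoint vmass n : vec n -> Z :=
  if n is m.+1 then fun v : seq (vec m) =>
    foldr (fun a s => Z.add (vmass a) s) Z0 (take m.+1 v) else id.

(** The tests concern an arbitrary table, so nothing about tableaux or the 0-Hecke algebra has to be
    proved: the transfer uses only what is tested here. Counting from 0, the corner of k is the box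
    (n - 2 - k, k), present iff row n - 2 - k is longer than k. *)
Definition kernel_check n (Y : seq (seq nat)) (K : seq nat -> vec n) :=
  [&& nseq n.-1 0%N \in Y, vnull (vsub (K (nseq n.-1 0%N)) (vunit n)) &
   all (fun la =>
     [&& all (fun b => grow b la \in Y) (boxes n),
         vmass (K la) == Z.one,
         vall (K la) (fun l => all (fun k =>
           top_block n k l == (k < nth 0%N la (n.-2 - k))%N) (iota 0 n.-1)) &
         vnull (vsub
           (foldr (fun b s => if grow b la == la then s
              else vadd (vsub (K (grow b la)) (K la)) s) (vzero n) (boxes n))
           (foldr (fun i s => vadd (vsub (vstep i (K la)) (K la)) s)
              (vzero n) (iota 0 n.-1)))]) Y].

Definition swap_growth_check n :=
  let T := kernel_table n in
  kernel_check (unzip1 T) (lookup T).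

(** * Slotwise description of the operations on signed measures *)

Lemma vadd_zero n : vadd (vzero n) (vzero n) = vzero n.
Proof. by case: n. Qed.

Lemma vopp_zero n : vopp (vzero n) = vzero n.
Proof. by case: n. Qed.

Lemma nth_vadd n (u v : vec n.+1) j :
  nth (vzero n) (vadd u v) j = vadd (nth (vzero n) u j) (nth (vzero n) v j).
Proof.
have vadd0 m (w : vec m) : vadd (vzero m) w = w by case: m w.
have vaddr0 m (w : vec m) : vadd w (vzero m) = w.
  by case: m w => [|m] w /=; [exact: Z.add_0_r | case: w].
elim: u v j => [|a u IH] [|b v] [|j] //=; rewrite ?vadd0 ?vaddr0 ?nth_nil //.
Qed.

Lemma nth_vopp n (v : vec n.+1) j :
  nth (vzero n) (vopp v) j = vopp (nth (vzero n) v j).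
Proof.
have [jv|vj] := ltnP j (size v); first by rewrite (nth_map (vzero n)).
by rewrite !nth_default ?size_map // vopp_zero.
Qed.

Lemma vmul_zero comb n i : vmul comb i (vzero n) = vzero n.
Proof. by case: n => //=; case: i. Qed.

Lemma nth_vstep n i (v : vec n.+1) j :
  nth (vzero n) (vstep i v) j =
    if (j < i)%N then vstep i.-1 (nth (vzero n) v j)
    else if j == i then vadd (nth (vzero n) v i) (nth (vzero n) v i.+1)
    else if j == i.+1 then vzero n
    else vstep i (nth (vzero n) v j).
Proof.
suff H f g k : f (vzero n) = vzero n -> g (vzero n) = vzero n ->
    nth (vzero n) (mul_slots (vzero n) (@vadd n) f g k v) j =
    if (j < k)%N then f (nth (vzero n) v j)
    else if j == k then vadd (nth (vzero n) v k) (nth (vzero n) v k.+1)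
    else if j == k.+1 then vzero n
    else g (nth (vzero n) v j) by apply: H; exact: vmul_zero.
move=> f0 g0; elim: v k j => [|a v IH] k j.
  rewrite (_ : mul_slots _ _ _ _ _ _ = [::]); last by case: k.
  rewrite !nth_nil f0 g0 vadd_zero.
  by case: ifP => // _; case: ifP => // _; case: ifP.
case: k => [|k]; last by case: j => //= j; rewrite IH.
case: v {IH} => [|b v]; case: j => [|[|j]] //=.
have [jv|vj] := ltnP j (size v); first by rewrite (nth_map (vzero n)).
by rewrite !nth_default ?size_map.
Qed.

Definition label_list n (l : seq nat) := (size l == n) && all (ltn^~ n) l.

Lemma pstep_size i l : size (pstep i l) = size l.
Proof.
elim: i l => [|i IH] [|a l] //=; last by rewrite IH.
by case: l => [|b r] //; case: ifP.
Qed.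

Lemma size_insert j x l : size (insert j x l) = (size l).+1.
Proof. by elim: j l => [|j IH] [|a l] //=; rewrite IH. Qed.

Lemma all_insert p j x l : all p (insert j x l) = p x && all p l.
Proof. by elim: j l => [|j IH] [|a l] //=; rewrite IH andbCA. Qed.

Lemma label_list_insert n j l :
  label_list n l -> label_list n.+1 (insert j n l).
Proof.
move=> /andP[/eqP nl ln]; rewrite /label_list size_insert nl eqxx all_insert.
by rewrite /= ltnSn /=; apply: sub_all ln => x; exact: ltnW.
Qed.

(** As m exceeds every other label, sorting at i leaves it at i when it stands at i or [i.+1].
    Otherwise, once m is removed, the sort at i acts at [i.-1] if m stands to the left and at i if
    it stands to the right. *)
Lemma pstep_insert m i j l : all (ltn^~ m) l -> (i < size l)%N ->
    (j <= size l)%N ->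
  pstep i (insert j m l) =
    if (j < i)%N then insert j m (pstep i.-1 l)
    else if (j == i) || (j == i.+1) then insert i m l
    else insert j m (pstep i l).
Proof.
elim: i j l => [|i IH] [|j] [|a l] //=.
- by move=> /andP[am _] _ _; rewrite ltnNge (ltnW am).
- case: j => [|j] /= /andP[am lm] _; first by move=> _; rewrite (_ : (a < m)%N).
  by case: l lm => [|b l] //= /andP[bm lm] jl; case: ifP.
- move=> /andP[am lm] il jl; rewrite IH // ltnS !eqSS.
  by case: i il {IH} => [|i] il //=; case: ifP => // _; case: ifP.
Qed.

(** * Integration of functions of label lists against signed measures *)

Section eval.
Variable R : pzRingType.

Definition zval (z : Z) : R := (int_of_Z z)%:~R.

(** The integral of F against the signed measure v. *)
Fixpoint ev n : vec n -> (seq nat -> R) -> R :=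
  if n is m.+1 then fun v F =>
    \sum_(j < m.+1) ev (nth (vzero m) v j) (fun l => F (insert j m l))
  else fun c F => zval c * F [::].

Lemma ev_ext n (v : vec n) F G :
  (forall l, label_list n l -> F l = G l) -> ev v F = ev v G.
Proof.
elim: n v F G => [|n IH] v F G FG /=; first by rewrite FG.
by apply: eq_bigr => j _; apply: IH => l nl; rewrite FG // label_list_insert.
Qed.

Lemma ev_zero n F : ev (vzero n) F = 0.
Proof.
elim: n F => [|n IH] F /=; first by rewrite /zval mul0r.
by apply: big1 => j _; rewrite nth_nil IH.
Qed.

Lemma ev_add n (u v : vec n) F : ev (vadd u v) F = ev u F + ev v F.
Proof.
elim: n u v F => [|n IH] u v F.
  by rewrite /= /zval -mulrDl -intrD; congr (_%:~R * _); lia.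
rewrite [LHS]/= -big_split /=; apply: eq_bigr => j _.
by rewrite -[X in nth _ X _]/(vadd (u : vec n.+1) v) nth_vadd IH.
Qed.

Lemma ev_opp n (v : vec n) F : ev (vopp v) F = - ev v F.
Proof.
elim: n v F => [|n IH] v F.
  by rewrite /= /zval -mulNr -intrN; congr (_%:~R * _); lia.
rewrite [LHS]/= -sumrN /=; apply: eq_bigr => j _.
by rewrite -[X in nth _ X _]/(vopp (v : vec n.+1)) nth_vopp IH.
Qed.

Lemma ev_sub n (u v : vec n) F : ev (vsub u v) F = ev u F - ev v F.
Proof. by rewrite ev_add ev_opp. Qed.

Lemma ev_null n (v : vec n) F : vnull v -> ev v F = 0.
Proof.
elim: n v F => [|n IH] v F /=.
  by case: v => //= _; rewrite /zval mul0r.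
move=> v0; apply: big1 => j _.
have [jv|vj] := ltnP j (size v); last by rewrite nth_default // ev_zero.
by rewrite IH // (all_nthP _ v0).
Qed.

Lemma ev_vsub_null n (u v : vec n) F : vnull (vsub u v) -> ev u F = ev v F.
Proof. by move=> /ev_null uv0; apply/eqP; rewrite -subr_eq0 -ev_sub uv0. Qed.

(** [vstep i] pushes the measure forward along [pstep i]. By [pstep_insert], slots i and [i.+1]
    merge into slot i, and the other slots follow by induction, with index [i.-1] or i. *)
Lemma ev_step n (v : vec n) i F : (i.+1 < n)%N ->
  ev (vstep i v) F = ev v (fun l => F (pstep i l)).
Proof.
elim: n v i F => [//|n IH] v i F; rewrite ltnS => iltn.
have step_insert (j : 'I_n.+1) l : label_list n l -> pstep i (insert j n l) =
    if (j < i)%N then insert j n (pstep i.-1 l)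
    else if (nat_of_ord j == i) || (nat_of_ord j == i.+1) then insert i n l
    else insert j n (pstep i l).
  move=> /andP[/eqP nl ln]; rewrite pstep_insert ?nl -1?ltnS //.
have i1 : (i < n.+1)%N by exact: ltnW.
have i2 : (i.+1 < n.+1)%N by [].
have i12 : (Ordinal i2 != Ordinal i1) by rewrite -val_eqE /= eqn_leq ltnn.
rewrite [LHS]/= [RHS]/= (bigD1 (Ordinal i1)) // [RHS](bigD1 (Ordinal i1)) //=.
rewrite (bigD1 (Ordinal i2)) // [in RHS](bigD1 (Ordinal i2)) //=.
rewrite !addrA; congr (_ + _).
  rewrite -[X in nth _ X _]/(vstep i (v : vec n.+1)).
  rewrite -[X in _ + ev (nth _ X _) _ = _]/(vstep i (v : vec n.+1)).
  rewrite !nth_vstep ltnn eqxx ltnNge leqnSn /= eqn_leq ltnn /= eqxx ev_zero addr0 ev_add.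
  congr (_ + _); apply: ev_ext => l nl.
    by rewrite (step_insert (Ordinal i1)) //= ltnn eqxx.
  by rewrite (step_insert (Ordinal i2)) //= ltnNge leqnSn /= eqxx orbT.
apply: eq_bigr => j /andP[ji1 ji2].
rewrite -[X in nth _ X _]/(vstep i (v : vec n.+1)) nth_vstep.
have ji : (nat_of_ord j == i) = false by apply/negbTE; rewrite -val_eqE in ji1.
have jSi : (nat_of_ord j == i.+1) = false by apply/negbTE; rewrite -val_eqE in ji2.
rewrite ji jSi; case: ifP => [jlti|jgei].
  rewrite IH; last by rewrite prednK // (leq_trans _ jlti).
  by apply: ev_ext => l nl; rewrite step_insert // jlti.
rewrite IH; last by move: (ltn_ord j); move: ji jSi jgei; lia.
by apply: ev_ext => l nl; rewrite step_insert // jgei ji jSi.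
Qed.

Lemma ev_unit n F : ev (vunit n) F = F (iota 0 n).
Proof.
elim: n F => [|n IH] F /=; first by rewrite /zval mul1r.
rewrite (bigD1 ord_max) //= big1 ?addr0 => [|j jmax].
  rewrite nth_ncons ltnn subnn /= IH; congr F.
  have insert_size (x : nat) l : insert (size l) x l = rcons l x.
    by elim: l => //= a l ->.
  rewrite -[X in insert X](size_iota 0 n) insert_size -cats1.
  by rewrite -[RHS]/(iota 0 n.+1) -[in RHS]addn1 iotaD.
have jn : (j < n)%N by rewrite ltn_neqAle -ltnS ltn_ord andbT.
by rewrite nth_ncons jn ev_zero.
Qed.

Lemma ev_mass n (v : vec n) : ev v (fun=> 1) = zval (vmass v).
Proof.
elim: n v => [|n IH] v; first by rewrite /= mulr1.
have zvalD a b : zval (Z.add a b) = zval a + zval b :> R.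
  by rewrite /zval -intrD; congr _%:~R; lia.
have -> : vmass v = foldr (fun a s => Z.add (vmass a) s) Z0 (take n.+1 v) by [].
rewrite [LHS]/=; under eq_bigr do rewrite IH.
suff H k (w : seq (vec n)) : \sum_(j < k) zval (vmass (nth (vzero n) w j)) =
  zval (foldr (fun a s => Z.add (vmass a) s) Z0 (take k w)) :> R by exact: H.
elim: k w {IH} => [|k IHk] [|a w] /=; rewrite ?big_ord0 //.
  by apply: big1 => j _; rewrite nth_nil; case: (n).
by rewrite big_ord_recl /= zvalD -IHk.
Qed.

Lemma ev_all n (v : vec n) (p : pred (seq nat)) F G : vall v p ->
  (forall l, p l -> F l = G l) -> ev v F = ev v G.
Proof.
elim: n v p F G => [|n IH] v p F G.
  by case: v => [|?|?] /= pn FG; [rewrite /zval !mul0r | rewrite FG..].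
move=> vp FG; rewrite /=; apply: eq_bigr => j _.
have [jv|vj] := ltnP j (size v); last by rewrite nth_default // !ev_zero.
apply: (IH _ (fun l => p (insert j n l))) => [|l pl]; last exact: FG.
move: vp => /=; set f := fun j a => _.
suff H k : all_slots f k v -> f (k + j)%N (nth (vzero n) v j) by move=> /H.
elim: v (nat_of_ord j) jv k {FG} => [//|a v IHv] [|i] /= iv k /andP[fa fv].
  by rewrite addn0.
by rewrite addnS -addSn; exact: IHv.
Qed.

Lemma ev_fun_sum n (v : vec n) (I : Type) (r : seq I) F :
  ev v (fun l => \sum_(i <- r) F i l) = \sum_(i <- r) ev v (F i).
Proof.
elim: n v F => [|n IH] v F /=; first by rewrite mulr_sumr.
by rewrite exchange_big /=; apply: eq_bigr => j _; rewrite IH.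
Qed.

Lemma ev_fun_sub n (v : vec n) F G :
  ev v (fun l => F l - G l) = ev v F - ev v G.
Proof.
elim: n v F G => [|n IH] v F G /=; first by rewrite mulrBr.
by rewrite -sumrB; apply: eq_bigr => j _; rewrite IH.
Qed.

End eval.

(** * Functions related by a kernel that passes the check *)

Section kernel.
Variables (R : pzRingType) (n : nat) (Y : seq (seq nat)) (K : seq nat -> vec n).
Hypothesis checkK : kernel_check Y K.

Definition intertwined (F G : seq nat -> R) :=
  forall la, la \in Y -> G la = ev (K la) F.

Let empty := nseq n.-1 0%N.

Lemma intertwined0 F G : intertwined F G -> G empty = F (iota 0 n).
Proof.
move: checkK => /and3P[Y0 K0 _] /(_ _ Y0) ->.
by rewrite (ev_vsub_null _ K0) ev_unit.
Qed.

Lemma intertwined1 : intertwined (fun=> 1) (fun=> 1).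
Proof.
move=> la laY; move: checkK => /and3P[_ _ /allP/(_ _ laY)/and4P[_ /eqP la1 _ _]].
by rewrite ev_mass la1 /zval.
Qed.

(** On the support of [K la] the block indicator is constant, equal to the corner indicator of la,
    so it comes out of the integral. *)
Lemma intertwined_block F G k : intertwined F G -> (k < n.-1)%N ->
  intertwined (fun l => (top_block n k l)%:R * F l)
    (fun la => (k < nth 0%N la (n.-2 - k))%N%:R * G la).
Proof.
move=> FG kn la laY; rewrite (FG _ laY).
move: checkK => /and3P[_ _ /allP/(_ _ laY)/and4P[_ _ laE _]].
rewrite [RHS](@ev_all _ _ (K la) _ _
    (fun l => (k < nth 0%N la (n.-2 - k))%N%:R * F l) laE); last first.
  by move=> l /allP/(_ k); rewrite mem_iota kn => /(_ isT)/eqP <-.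
case: (k < _)%N; first by rewrite mul1r; apply: ev_ext => l _; rewrite mul1r.
rewrite mul0r (ev_ext _ (G := fun l => F l - F l)) ?ev_fun_sub ?subrr // => l _.
by rewrite mul0r subrr.
Qed.

Lemma intertwined_generator F G : intertwined F G ->
  intertwined (fun l => \sum_(i < n.-1) (F (pstep i l) - F l))
    (fun la => \sum_(b <- boxes n) (G (grow b la) - G la)).
Proof.
move=> FG la laY.
move: checkK => /and3P[_ _ /allP/(_ _ laY)/and4P[/allP laY' _ _ /ev_vsub_null]].
move=> /(_ R F) laQ.
transitivity (ev (foldr (fun b s => if grow b la == la then s
    else vadd (vsub (K (grow b la)) (K la)) s) (vzero n) (boxes n)) F).
  elim: (boxes n) laY' {laQ} => [|b bs IH] laY'; first by rewrite big_nil /= ev_zero.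
  rewrite big_cons /= IH; last by move=> c cbs; apply: laY'; rewrite inE cbs orbT.
  (* The check skips the boxes that cannot be added; their terms vanish. *)
  case: eqP => [->|_]; first by rewrite subrr add0r.
  by rewrite ev_add ev_sub -!FG // laY' // mem_head.
rewrite {}laQ.
have -> : ev (foldr (fun i s => vadd (vsub (vstep i (K la)) (K la)) s)
    (vzero n) (iota 0 n.-1)) F =
    \sum_(i <- iota 0 n.-1) ev (K la) (fun l => F (pstep i l) - F l).
  have : all (ltn^~ n.-1) (iota 0 n.-1).
    by apply/allP => i; rewrite mem_iota.
  elim: (iota 0 n.-1) => [|i s IH] /=; first by rewrite big_nil ev_zero.
  move=> /andP[iltn /IH {}IH]; rewrite big_cons ev_add IH ev_sub ev_step.
    by congr (_ + _); rewrite ev_fun_sub.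
  by rewrite -ltn_predRL.
rewrite -[n.-1 in LHS]subn0 -/(index_iota 0 n.-1) big_mkord.
by rewrite ev_fun_sum.
Qed.

End kernel.

(** * Independence of the past *)

Section past.
Context {R : realType} d (T : measurableType d) (P : probability T R).
Context (I : choiceType) (X : I -> {RV P >-> R}).

(** Finite intersections are taken so that these sets form a pi-system generating [past J]. *)
Definition cylinders (J : set I) : set (set T) :=
  [set A | exists F : {fset I}, exists B : I -> set R,
     [/\ [set` F] `<=` J, forall i, measurable (B i) &
         A = \bigcap_(i in [set` F]) (X i @^-1` B i)]].

Definition past (J : set I) : set (set T) := <<s cylinders J >>.

Lemma cylinder_measurable J : cylinders J `<=` measurable.
Proof.
move=> _ [F [B [_ mB ->]]]; apply: fin_bigcap_measurable => [|i _]; first exact: finite_fset.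
by rewrite -[X in measurable X]setTI; exact: measurable_funPT.
Qed.

Lemma past_measurable J : past J `<=` measurable.
Proof.
by apply: smallest_sub; [exact: sigma_algebra_measurable|exact: cylinder_measurable].
Qed.

Lemma past_mono J J' : J `<=` J' -> past J `<=` past J'.
Proof.
move=> JJ'; apply: sub_smallest2r; first exact: smallest_sigma_algebra.
move=> _ [F [B [FJ mB ->]]]; by exists F, B; split => // i /FJ /JJ'.
Qed.

Lemma past_measurable_fun J i : J i ->
  measurable_fun setT (X i : g_sigma_algebraType (cylinders J) -> R).
Proof.
move=> Ji _ B mB; rewrite setTI; apply: sub_sigma_algebra.
exists [fset i]%fset, (fun=> B); split => //.
  by move=> j /=; rewrite inE => /eqP ->.
by rewrite set_fset1 bigcap_set1.
Qed.

Lemma past_setI J A B : past J A -> past J B -> past J (A `&` B).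
Proof. exact: (@measurableI _ (g_sigma_algebraType (cylinders J))). Qed.

Lemma past_setT J : past J setT.
Proof. exact: (@measurableT _ (g_sigma_algebraType (cylinders J))). Qed.

Hypothesis indepX : mutually_independent X.

(** Both sides are finite measures in A. They agree on cylinders, by mutual independence for the
    indices of the cylinder together with i, hence on the generated sigma-algebra. *)
Lemma past_independent J i A B : past J A -> ~ J i -> measurable B ->
  P (A `&` X i @^-1` B) = (P A * P (X i @^-1` B))%E.
Proof.
move=> JA Ji mB.
have mXB : measurable (X i @^-1` B).
  by rewrite -[X in measurable X]setTI; exact: measurable_funPT.
pose p : {nonneg R} := NngNum (fine_ge0 (measure_ge0 P (X i @^-1` B))).
pose m1 := [the measure _ _ of mrestr P mXB].
pose m2 := [the measure _ _ of mscale p P].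
have -> : (P A * P (X i @^-1` B) = m2 A)%E.
  by rewrite /m2/= /mscale/= fineK ?fin_num_measure// muleC.
have -> : P (A `&` X i @^-1` B) = m1 A by [].
apply: (@g_sigma_algebra_measure_unique _ _ _ (cylinders J) _ (fun=> setT)) JA.
- exact: cylinder_measurable.
- move=> _; exists fset0, (fun=> setT); split => //.
  by rewrite set_fset0 bigcap_set0.
- by rewrite bigcup_const//; exists 0%N.
- move=> _ _ [F [B1 [FJ mB1 ->]]] [G [B2 [GJ mB2 ->]]].
  exists (F `|` G)%fset, (fun j => (if j \in F then B1 j else setT) `&`
    (if j \in G then B2 j else setT)).
  split.
  + by move=> j /=; rewrite inE => /orP[/FJ|/GJ].
  + by move=> j; apply: measurableI; case: ifP.
  + apply/seteqP; split=> [w [F1 G1] j /= _|w FG1].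
      by split; case: ifP => //; [exact: F1|exact: G1].
    by split=> j /= jF; have /= := FG1 j; rewrite inE jF ?orbT => /(_ isT)[].
- move=> _ [F [B1 [FJ mB1 ->]]].
  rewrite /m1/m2/= /mrestr /mscale/= fineK ?fin_num_measure//.
  have iF : i \notin F by apply/negP => /FJ.
  pose B2 j := if j == i then B else B1 j.
  have B2F j : j \in F -> B2 j = B1 j.
    by move=> jF; rewrite /B2; case: eqP => // ji; rewrite -ji jF in iF.
  have := indepX (i |` F)%fset (A := B2); rewrite big_fsetU1//=.
  rewrite [in RHS](_ : B2 i = B); last by rewrite /B2 eqxx.
  have mB2 j : measurable (B2 j) by rewrite /B2; case: ifP.
  move=> /(_ mB2).
  rewrite set_fsetU1 bigcap_setU1 [in LHS](_ : B2 i = B); last by rewrite /B2 eqxx.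
  rewrite setIC (eq_bigcapr (G := fun j => X j @^-1` B1 j)); last first.
    by move=> j /= jF; rewrite B2F.
  move=> ->; rewrite indepX//; congr (_ * _)%E.
  by rewrite big_seq [RHS]big_seq; apply: eq_bigr => j jF; rewrite B2F.
- by move=> _; rewrite /m1/= /mrestr setTI ltey_eq fin_num_measure.
Qed.

End past.

(** * Lower bounds for the ring patterns of independent clocks *)

Section exponential_variable.
Context {R : realType} d (T : measurableType d) (P : probability T R).

(** As an inequality this also holds for v <= u, where the left side is not positive; its use below
    does not control the order of the endpoints. *)
Lemma exponential_interval (X : {RV P >-> R}) (u v : R) :
  (forall A, measurable A -> distribution P X A = exponential_prob 1 A) ->
  0 <= u ->
  expR (- u) - expR (- v) <= fine (P (X @^-1` [set x | u <= x < v])).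
Proof.
move=> expX u0; have [vu|uv] := leP v u.
  apply: (@le_trans _ _ 0); last exact: fine_ge0.
  by rewrite subr_le0 ler_expR lerN2.
have mX A : measurable A -> measurable (X @^-1` A).
  by move=> mA; rewrite -[X in measurable X]setTI; exact: measurable_funPT.
have cdfX (x : R) : 0 < x -> P (X @^-1` `[0, x[) = (1 - (expR (- x))%:E)%E.
  move=> x0; transitivity (distribution P X `[0, x[%classic); first by [].
  rewrite expX// /exponential_prob integral_itv_bndo_bndc; last first.
    apply/measurable_EFinP; apply: measurable_funTS.
    exact: measurable_exponential_pdf.
  by rewrite -/(exponential_prob 1 _) exponential_prob_itv0c// mulN1r.
have m0 x : measurable (X @^-1` `[0, x[) by exact: mX.
have -> : X @^-1` [set x | u <= x < v] =
    (X @^-1` `[0, v[) `\` (X @^-1` `[0, u[).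
  apply/seteqP; split=> x /=; rewrite !in_itv/=.
    by move=> /andP[ux xv]; rewrite (le_trans u0 ux) xv; split=> //; rewrite ltNge ux.
  by move=> [/andP[-> ->] /negP]; rewrite -leNgt andbT.
have -> : P ((X @^-1` `[0, v[) `\` (X @^-1` `[0, u[)) =
    (P (X @^-1` `[0%R, v[) - P (X @^-1` `[0%R, u[))%E.
  rewrite measureD//; last by rewrite ltey_eq fin_num_measure.
  rewrite setIidr// => x /=; rewrite !in_itv/= => /andP[-> xu].
  by rewrite (lt_trans xu).
rewrite cdfX ?(le_lt_trans u0)//.
have [->|uneq0] := eqVneq u 0.
  by rewrite set_itvco0 preimage_set0 measure0 sube0 oppr0 expR0.
by rewrite cdfX ?lt0r ?uneq0// -!EFinB/=; lra.
Qed.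

End exponential_variable.

Section one_clock.
Context {R : realType} d (T : measurableType d) (P : probability T R).
Context (C : finType) (gap : C -> nat -> {RV P >-> R}).
Hypothesis clocks : independent_poisson_clocks gap.

Let X (e : C * nat) := gap e.1 e.2.

Definition ring_rv e w := ring_time (fun c m => gap c m w) e.

Definition ring_in e x y := [set w | x <= ring_rv e w < y].

(** The gaps that determine ring m of c, together with a family J that will consist of gaps of other
    clocks. *)
Definition early (J : set (C * nat)) c m := J `|` [set e | e.1 = c /\ (e.2 <= m)%N].

Lemma ringS c m w : ring_rv (c, m.+1) w = ring_rv (c, m) w + gap c m.+1 w.
Proof. by rewrite /ring_rv /ring_time big_ord_recr. Qed.

Lemma past_ring J c m :
  measurable_fun setT
    (ring_rv (c, m) : g_sigma_algebraType (cylinders X (early J c m)) -> R).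
Proof.
apply: measurable_sum => -[l lm].
by apply: (past_measurable_fun (X := X) (i := (c, l))); right.
Qed.

Lemma past_ring_in J c m x y : past X (early J c m) (ring_in (c, m) x y).
Proof.
have -> : ring_in (c, m) x y = ring_rv (c, m) @^-1` `[x, y[.
  by apply/seteqP; split => w /=; rewrite in_itv.
by rewrite -[X in past _ _ X]setTI; exact: (@past_ring J c m measurableT _ (measurable_itv `[x, y[)).
Qed.

Lemma past_ring_ge J c m x : past X (early J c m) [set w | x <= ring_rv (c, m) w].
Proof.
have -> : [set w | x <= ring_rv (c, m) w] = ring_rv (c, m) @^-1` `[x, +oo[.
  by apply/seteqP; split => w /=; rewrite in_itv/= andbT.
by rewrite -[X in past _ _ X]setTI; exact: (@past_ring J c m measurableT _ (measurable_itv `[x, +oo[)).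
Qed.

Lemma ge_of_nat (a b c : R) :
  (forall n, a - b / n.+1%:R <= c) -> a <= c.
Proof.
move=> H; apply/ler_addgt0Pr => e e0.
have [b0|b0] := leP b 0.
  have := H 0%N; rewrite divr1; lra.
have [n nb] : exists n : nat, b / e < n%:R.
  exists (Num.trunc (b / e)).+1; apply: truncnS_gt.
have := H n; rewrite lerBlDr => /le_trans; apply; rewrite lerD2l.
rewrite ler_pdivrMr// mulrC -ler_pdivrMr//; apply/ltW/(lt_trans nb).
by rewrite ltr_nat.
Qed.

(** On A, ring m of c has density at least q exp(-x) from s on. The factor exp(-x) of a ring and the
    factor exp(-(y - x)) of the next gap multiply to exp(-y), so requiring a ring in a window of
    width h only turns q into q h. *)
Definition exponential_tail A q s c m := forall x y, s <= x -> x <= y ->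
  q * (expR (- x) - expR (- y)) <= fine (P (A `&` ring_in (c, m) x y)).

(* Cut [s, s + h[ into n pieces; on each of them the next gap is independent
   of the past, and its constraint loses only a factor expR (h / n). *)
Lemma exponential_tailS J c m A q s h :
  (forall l, ~ J (c, l)) -> past X (early J c m) A ->
  0 <= q -> 0 <= h -> exponential_tail A q s c m ->
  exponential_tail (A `&` ring_in (c, m) s (s + h)) (q * h) (s + h) c m.+1.
Proof.
move=> Jc pA q0 h0 tailA b b' shb bb'.
apply: (@ge_of_nat _ (q * h * (expR (- b) * h))) => n.
set Q := fine _; have Q0 : 0 <= Q by exact: fine_ge0.
pose x i := s + i%:R * (h / n.+1%:R).
set dt := h / n.+1%:R; have dt0 : 0 <= dt by rewrite divr_ge0.
have xS i : x i.+1 = x i + dt by rewrite /x -natr1 mulrDl mul1r addrA.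
have sx i : s <= x i by rewrite lerDl mulr_ge0.
have xn : x n.+1 = s + h by rewrite /x mulrC divfK.
have x_le i j : (i <= j)%N -> x i <= x j by move=> ij; rewrite lerD2l ler_wpM2r// ler_nat.
(* The interval for the gap fits every position of the ring in its piece, so the next ring falls in
   [b, b'[; the interval may be empty. *)
pose Ei i := (A `&` ring_in (c, m) (x i) (x i.+1)) `&`
  (gap c m.+1 @^-1` [set g | b - x i <= g < b' - x i.+1]).
have pEi i : past X (early J c m) (A `&` ring_in (c, m) (x i) (x i.+1)).
  by apply: past_setI => //; exact: past_ring_in.
have mitv u v : measurable [set g : R | u <= g < v].
  have -> : [set g : R | u <= g < v] = `[u, v[%classic by apply/seteqP; split => g /=; rewrite in_itv.
  exact: measurable_itv.
have mEi i : measurable (Ei i).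
  apply: measurableI; first exact: past_measurable (pEi i).
  by rewrite -[X in measurable X]setTI; exact: measurable_funPT.
have PEi (i : 'I_n.+1) : q * (1 - expR (- dt)) * (expR (- b) - expR (- b') * expR dt) <= fine (P (Ei i)).
  rewrite (past_independent (X := X) (i := (c, m.+1)) clocks.2 (pEi i))//; last first.
    by move=> [/Jc//|[_]] /=; rewrite ltnn.
  rewrite fineM ?fin_num_measure//; last 2 first.
    exact: past_measurable (pEi i).
    by rewrite -[X in measurable X]setTI; exact: measurable_funPT.
  have := tailA _ _ (sx i) (x_le _ _ (leqnSn i)).
  have := @exponential_interval _ _ _ _ (gap c m.+1) (b - x i) (b' - x i.+1) (clocks.1 _ _).
  have -> : 0 <= b - x i.
    by rewrite subr_ge0 (le_trans _ shb)// -xn x_le// ltnW.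
  move=> /(_ isT) gapE ringE.
  apply: le_trans (ler_wpM2r _ ringE); last exact: fine_ge0.
  have a0 : 0 <= q * (expR (- x i) - expR (- x i.+1)).
    by rewrite mulr_ge0// subr_ge0 ler_expR lerN2 x_le.
  apply: le_trans (ler_wpM2l a0 gapE).
  rewrite le_eqVlt; apply/orP; left; apply/eqP.
  rewrite xS !opprB !opprD ?opprK !expRD !expRN.
  by field; rewrite !gt_eqF ?expR_gt0.
have sumE : \sum_(i < n.+1) fine (P (Ei i)) <= Q.
  have tE : trivIset setT (fun i : nat => Ei i).
    apply/trivIsetP => i j _ _; wlog ij : i j / (i < j)%N => [H|_].
      by rewrite neq_ltn => /orP[]ij; [|rewrite setIC]; apply: H; rewrite // neq_ltn ij.
    apply/seteqP; split=> // w [[[_ /andP[_ wi]] _] [[_ /andP[wj _]] _]].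
    by have := lt_le_trans wi (le_trans (x_le _ _ ij) wj); rewrite ltxx.
  have sumP : P (\big[setU/set0]_(i < n.+1) Ei i) = (\sum_(i < n.+1) P (Ei i))%E.
    by apply: measure_bigsetU_ord => // i j _ _ /(tE _ _ I I)/val_inj.
  have -> : \sum_(i < n.+1) fine (P (Ei i)) = fine (\sum_(i < n.+1) P (Ei i))%E.
    by rewrite -sum_fine// => i _; rewrite fin_num_measure.
  have sub : \big[setU/set0]_(i < n.+1) Ei i `<=`
      A `&` ring_in (c, m) s (s + h) `&` ring_in (c, m.+1) b b'.
    rewrite -bigcup_mkord => w [i /= ilt [[Aw /andP[xi ix]] /andP[gb bg]]].
    have wn : x i.+1 <= s + h by rewrite -xn x_le.
    split; first split => //.
      by apply/andP; split; [exact: le_trans (sx i) xi|exact: lt_le_trans ix wn].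
    by rewrite /ring_in/= ringS; apply/andP; split; lra.
  have mfin : measurable (A `&` ring_in (c, m) s (s + h) `&` ring_in (c, m.+1) b b').
    have sub1 : early J c m `<=` early J c m.+1.
      by move=> e [|[ec em]]; [left|right; split => //; exact: leqW].
    apply: (@past_measurable _ _ _ P _ X (early J c m.+1)).
    apply: past_setI; last exact: past_ring_in.
    by apply: (past_mono sub1); apply: past_setI => //; exact: past_ring_in.
  rewrite /Q -sumP fine_le ?fin_num_measure ?le_measure ?inE//.
  - exact: bigsetU_measurable.
  - exact: bigsetU_measurable.
have nK : n.+1%:R * dt = h by rewrite mulrC divfK.
have : n.+1%:R * (q * (1 - expR (- dt)) * (expR (- b) - expR (- b') * expR dt)) <= Q.
  apply: le_trans sumE; rewrite mulr_natl -[n.+1 in leLHS]card_ord -sumr_const.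
  by apply: ler_sum.
move: (expR_ge1Dx dt) (expR_ge1Dx (- dt)) (expR_gt0 (- b)) (expR_gt0 (- dt)).
have : expR (- dt) * expR dt = 1 by rewrite expRN mulVf// gt_eqF ?expR_gt0.
set D := expR dt; set D' := expR (- dt); set B := expR (- b); set B' := expR (- b').
move=> D'D D1 D'1 B0 D'0 QE.
have qh0 : 0 <= q * h by rewrite mulr_ge0.
have -> : q * h * (B - B') - q * h * (B * h) / n.+1%:R = q * h * (B * (1 - dt) - B').
  rewrite /dt; ring.
apply: (@le_trans _ _ (q * h * (B * D' - B'))).
  by rewrite ler_wpM2l// lerD2r ler_pM2l//; lra.
(* A negative factor makes the bound trivial; otherwise it follows from
   [(1 - D') * D = D - 1 >= dt]. *)
have [K0|K0] := leP 0 (B * D' - B'); last first.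
  by apply: le_trans Q0; rewrite mulr_ge0_le0// ltW.
apply: le_trans QE.
have -> : q * h * (B * D' - B') = n.+1%:R * (q * (dt * (B * D' - B'))).
  by rewrite -nK; ring.
rewrite -mulrA ler_wpM2l// ler_wpM2l//.
have -> : B - B' * D = (B * D' - B') * D by rewrite mulrBl -mulrA D'D mulr1.
have -> : (1 - D') * ((B * D' - B') * D) = (D - 1) * (B * D' - B').
  have <- : D * (1 - D') = D - 1 by rewrite mulrBr mulr1 [D * D']mulrC D'D.
  by ring.
by rewrite ler_wpM2r//; lra.
Qed.

End one_clock.

Section patterns.
Context {R : realType} d (T : measurableType d) (P : probability T R).
Context (C : finType) (gap : C -> nat -> {RV P >-> R}).
Hypothesis clocks : independent_poisson_clocks gap.

Let X (e : C * nat) := gap e.1 e.2.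

Local Notation ring := (ring_rv gap).
Local Notation ring_in := (ring_in gap).

(* Each cell is a width together with whether it contains a ring of c; from
   time s on, the first ring of c is the m-th one. *)
Fixpoint pattern_event c m s (cells : seq (R * bool)) : set T :=
  match cells with
  | [::] => [set w | s <= ring (c, m) w]
  | (h, b) :: cells' =>
    if b then ring_in (c, m) s (s + h) `&` pattern_event c m.+1 (s + h) cells'
    else pattern_event c m (s + h) cells'
  end.

(** For a Poisson process of rate 1, the probability of exactly one ring, or of none, in a cell of
    width [x.1]. *)
Definition cell_weight (x : R * bool) := expR (- x.1) * (if x.2 then x.1 else 1).

Lemma pattern_event_past (J : set (C * nat)) c m s cells :
  past X (J `|` [set e | e.1 = c]) (pattern_event c m s cells).
Proof.
have sub k : early J c k `<=` J `|` [set e | e.1 = c].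
  by move=> e [|[]]; [left|right].
elim: cells m s => [|[h [] cells IH]] m s /=.
- by apply: (past_mono (@sub m)); exact: past_ring_ge.
- by apply: past_setI => //; apply: (past_mono (@sub m)); exact: past_ring_in.
- exact: IH.
Qed.

Lemma pattern_event_measurable c m s cells : measurable (pattern_event c m s cells).
Proof. exact: past_measurable (@pattern_event_past set0 c m s cells). Qed.

(** A cell with a ring multiplies q by its width, an empty cell only moves s. The exponential
    factors all come from the last condition, that the next ring falls after the end of the
    pattern. *)
Lemma pattern_event_ge J c m s A q cells :
  (forall l, ~ J (c, l)) -> past X (early J c m) A -> 0 <= q -> 0 <= s ->
  {in cells, forall x, 0 <= x.1} -> exponential_tail gap A q s c m ->
  q * expR (- s) * \prod_(x <- cells) cell_weight x <=
    fine (P (A `&` pattern_event c m s cells)).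
Proof.
move=> Jc; elim: cells m s A q => [|[h b] cells IH] m s A q pA q0 s0 cells0 tailA.
  (* Restricting the ring to [s, s + n[ loses [q * expR (- (s + n%:R))], at most [q / n.+1]. *)
  rewrite big_nil mulr1; apply: (@ge_of_nat _ _ q) => n.
  apply: (@le_trans _ _ (fine (P (A `&` ring_in (c, m) s (s + n%:R))))); last first.
    have mA k : measurable (A `&` ring_in (c, m) s k).
      by apply: past_measurable (past_setI pA (@past_ring_in _ _ _ _ _ _ J _ _ _ _)).
    have mA' : measurable (A `&` pattern_event c m s [::]).
      by apply: past_measurable (past_setI pA (@past_ring_ge _ _ _ _ _ _ J _ _ _)).
    rewrite fine_le ?fin_num_measure// le_measure ?inE//.
    by apply: setIS => w /andP[].
  apply: le_trans (tailA _ _ _ _) => //; last by rewrite lerDl.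
  rewrite mulrBr lerD2l lerN2 ler_wpM2l// expRN lef_pV2 ?posrE ?expR_gt0//.
  by apply: le_trans (expR_ge1Dx _); rewrite -natr1; lra.
have h0 : 0 <= h by apply: (cells0 (h, b)); rewrite mem_head.
have sh0 : 0 <= s + h by rewrite addr_ge0.
have {}cells0 : {in cells, forall x, 0 <= x.1}.
  by move=> x xc; apply: cells0; rewrite inE xc orbT.
rewrite big_cons {1}/cell_weight /=; case: b.
  rewrite setIA; apply: le_trans (IH _ _ _ _ _ _ sh0 cells0 (exponential_tailS _ Jc pA q0 h0 tailA)) => //.
  - by rewrite opprD expRD; lra.
  - have sub : early J c m `<=` early J c m.+1.
      by move=> e [|[ec em]]; [left|right; split => //; exact: leqW].
    by apply: (past_mono sub); apply: past_setI => //; exact: past_ring_in.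
  - exact: mulr_ge0.
apply: le_trans (IH _ _ _ _ pA q0 sh0 cells0 _).
- by rewrite opprD expRD; lra.
- move=> x y shx xy; apply: tailA => //; lra.
Qed.

(** One clock at a time: once the pattern of c is imposed, all gaps of c join J, and the remaining
    clocks are independent of them. *)
Lemma patterns_ge J A (cells : C -> seq (R * bool)) (cs : seq C) :
  uniq cs -> (forall c l, c \in cs -> ~ J (c, l)) -> past X J A ->
  (forall c, {in cells c, forall x, 0 <= x.1}) ->
  fine (P A) * \prod_(c <- cs) \prod_(x <- cells c) cell_weight x <=
  fine (P (A `&` \bigcap_(c in [set` cs]) pattern_event c 0 0 (cells c))).
Proof.
move=> + + + cells0; elim: cs J A => [|c cs IH] J A.
  by move=> _ _ pA; rewrite big_nil mulr1 set_nil bigcap_set0 setIT.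
rewrite cons_uniq => /andP[ccs ucs] Jcs pA.
have Jc l : ~ J (c, l) by apply: Jcs; rewrite mem_head.
have -> : [set` c :: cs] = c |` [set` cs].
  by apply/seteqP; split=> c' /=; rewrite inE => /predU1P; tauto.
rewrite big_cons bigcap_setU1 setIA mulrA.
have mA := past_measurable pA.
have tailA : exponential_tail gap A (fine (P A)) 0 c 0.
  move=> x y x0 xy.
  have -> : ring_in (c, 0%N) x y = X (c, 0%N) @^-1` [set g | x <= g < y].
    apply/seteqP; split=> w; rewrite /ring_in/= /ring_rv /ring_time big_ord1//.
  have mitv : measurable [set g : R | x <= g < y].
    have -> : [set g : R | x <= g < y] = `[x, y[%classic.
      by apply/seteqP; split => g /=; rewrite in_itv.
    exact: measurable_itv.
  rewrite (past_independent clocks.2 pA)//.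
  rewrite fineM ?fin_num_measure//; last first.
    by rewrite -[X in measurable X]setTI; exact: measurable_funPT.
  by rewrite ler_wpM2l ?fine_ge0//; apply: exponential_interval => //; exact: clocks.1.
apply: le_trans (IH (J `|` [set e | e.1 = c]) _ ucs _ _).
- apply: ler_wpM2r.
    by apply: prodr_ge0 => c' _; rewrite big_seq; apply: prodr_ge0 => x xc;
      rewrite mulr_ge0 ?expR_ge0//; case: x.2 => //; apply: cells0 xc.
  apply: le_trans (pattern_event_ge Jc _ _ _ (@cells0 c) tailA) => //.
  + by rewrite oppr0 expR0 mulr1.
  + apply: past_mono pA; exact: subsetUl.
  + exact: fine_ge0.
- move=> c' l c'cs [/Jcs|/= cc']; first by apply; rewrite inE c'cs orbT.
  by rewrite -cc' c'cs in ccs.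
- apply: past_setI; last exact: pattern_event_past.
  apply: past_mono pA; exact: subsetUl.
Qed.

Definition cells_of (pat : seq (R * option C)) c := [seq (x.1, x.2 == Some c) | x <- pat].

Definition joint_pattern (k : C -> nat) s pat :=
  [set w | forall c, pattern_event c (k c) s (cells_of pat c) w].

(** After exchanging the products over clocks and cells, a cell of width h collects [expR (- h)]
    from every clock, and a factor h from the clock that rings in it, if any. *)
Lemma joint_pattern_ge pat : {in pat, forall x, 0 <= x.1} ->
  \prod_(x <- pat) (expR (- (#|C|%:R * x.1)) * (if isSome x.2 then x.1 else 1)) <=
  fine (P (joint_pattern (fun=> 0%N) 0 pat)).
Proof.
move=> pat0.
have cells0 c : {in cells_of pat c, forall x, 0 <= x.1}.
  by move=> _ /mapP[x xp ->]; exact: pat0.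
have := @patterns_ge set0 setT (cells_of pat) (enum C) (enum_uniq _) (fun _ _ _ => id)
  (@past_setT _ _ _ P _ X set0) cells0.
rewrite probability_setT mul1r setTI.
have -> : \bigcap_(c in [set` enum C]) pattern_event c 0 0 (cells_of pat c) =
    joint_pattern (fun=> 0%N) 0 pat.
  apply/seteqP; split=> w /= H c; last by move=> _; exact: H.
  by apply: H; rewrite /= mem_enum.
apply: le_trans; rewrite le_eqVlt; apply/orP; left; apply/eqP.
under [RHS]eq_bigr do rewrite big_map.
rewrite exchange_big/=; apply: eq_bigr => -[h o] _ /=.
rewrite big_split/= !big_enum/= prodr_const; congr (_ * _).
  by rewrite -expRM_natl mulrN.
case: o => [c0|]; last by rewrite big1.
rewrite (bigD1 c0)//= eqxx big1 ?mulr1// => c cc0.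
by case: eqP => // -[c0c]; rewrite c0c eqxx in cc0.
Qed.

End patterns.

(** * Last change times as entrance times *)

Section listings.
Context {R : realType} {C : finType}.
Variable gap : C -> nat -> R.

Local Notation ring := (ring_time gap).

(** Such an L exists iff finitely many rings precede t and their times are distinct; strict sorting
    makes it unique. *)
Definition listing t (L : seq (C * nat)) :=
  sorted (fun e f => ring e < ring f) L /\ forall e, (e \in L) = (ring e < t).

Let ltr_trans : transitive (fun e f => ring e < ring f).
Proof. by move=> ? ? ?; exact: lt_trans. Qed.

Let ltr_irr : irreflexive (fun e f => ring e < ring f).
Proof. by move=> ?; exact: ltxx. Qed.

Lemma listing_uniq t L L' : listing t L -> listing t L' -> L = L'.
Proof.
move=> [sL mL] [sL' mL']; apply: irr_sorted_eq ltr_irr _ _ sL sL' _ => //.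
by move=> e; rewrite mL mL'.
Qed.

Lemma listing_cat t t' L L' : t <= t' -> listing t L -> listing t' L' ->
  exists2 M, L' = L ++ M & {in M, forall e, t <= ring e}.
Proof.
move=> tt' [sL mL] [sL' mL']; exists [seq e <- L' | t <= ring e]; last first.
  by move=> e; rewrite mem_filter => /andP[].
apply: (irr_sorted_eq ltr_trans ltr_irr sL').
  rewrite sorted_pairwise// pairwise_cat -!sorted_pairwise// sL sorted_filter//= andbT.
  apply/allrelP => e f; rewrite mL mem_filter => et /andP[tf _].
  exact: lt_le_trans tf.
move=> e; rewrite mem_cat mem_filter mL mL'; case: (ltP (ring e) t) => //= et.
by rewrite (lt_le_trans et tt').
Qed.

Lemma listing_rcons e t L L' : ring e < t -> listing (ring e) L ->
  listing t L' -> exists M, L' = rcons L e ++ M.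
Proof.
move=> et Le Lt; have [M LM Mge] := listing_cat (ltW et) Le Lt.
have := Lt.2 e; rewrite et LM mem_cat Le.2 ltxx /=.
case: M LM Mge => [//|f M] LM Mge; rewrite inE => /predU1P[->|eM].
  by exists M; rewrite cat_rcons.
have := Lt.1; rewrite LM sorted_pairwise// pairwise_cat => /and3P[_ _ /=].
move=> /andP[/allP/(_ _ eM) fe _].
by have := Mge f; rewrite mem_head leNgt fe => /(_ isT).
Qed.

Lemma listing_prefix t L e M : listing t (L ++ e :: M) -> listing (ring e) L.
Proof.
move=> [sL mL]; move: (sL); rewrite sorted_pairwise// pairwise_cat.
move=> /and3P[/allrelP LM pL /= /andP[/allP eM pM]].
split; first by rewrite sorted_pairwise.
move=> f; apply/idP/idP => [fL|fe]; first by apply: LM; rewrite ?mem_head.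
have : f \in L ++ e :: M.
  by rewrite mL (lt_trans fe)// -mL mem_cat mem_head orbT.
rewrite mem_cat inE => /or3P[//|/eqP fe'|/eM ef]; first by rewrite fe' ltxx in fe.
by have := lt_trans ef fe; rewrite ltxx.
Qed.

Lemma listing_le t t' L' : t <= t' -> listing t' L' ->
  listing t [seq e <- L' | ring e < t].
Proof.
move=> tt' [sL mL]; split; first exact: sorted_filter.
move=> e; rewrite mem_filter mL; case: (ltP (ring e) t) => //= et.
by rewrite (lt_le_trans et tt').
Qed.

Lemma state_before_listing (S : eqType) (step : C -> S -> S) s0 t L :
  listing t L ->
  state_before step s0 gap t = foldl (fun s e => step e.1 s) s0 L.
Proof.
move=> [sL mL]; rewrite /state_before.
have -> : [set e | ring e < t] = [set` L].
  by apply/seteqP; split => e /=; rewrite mL.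
congr foldl; set F := fset_set _.
have memF e : (e \in F) = (e \in L).
  by rewrite in_fset_set ?mem_setE//; exact: finite_seq.
set s := sort _ _.
have mems e : (e \in s) = (e \in L) by rewrite mem_sort memF.
have us : uniq s by rewrite sort_uniq fset_uniq.
have uL : uniq L by exact: sorted_uniq sL.
have sLs : perm_eq s L by apply: uniq_perm.
have : sorted <%R (map ring s).
  rewrite lt_sorted_uniq_le; apply/andP; split.
    rewrite (perm_uniq (perm_map ring sLs)).
    by apply: (sorted_uniq lt_trans ltxx); rewrite sorted_map.
  by rewrite sorted_map; apply: sort_sorted => e f; exact: le_total.
rewrite sorted_map => ss; exact: irr_sorted_eq ltr_irr _ _ ss sL mems.
Qed.

End listings.

Section last_change.
Context {R : realType} {C : finType} {S : eqType}.
Variables (step : C -> S -> S) (s0 : S) (gap : C -> nat -> R).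
Variables (k : C) (E : pred S) (rank : S -> nat) (bound : nat).

Local Notation ring := (ring_time gap).
Local Notation run := (foldl (fun s c => step c s)).

Record entered_by : Prop := EnteredBy {
  entered_init : ~~ E s0;
  entered_stable : forall c s, E s -> E (step c s);
  entered_fixed : forall s, E s -> step k s = s;
  entered_through : forall c s, c != k -> E (step c s) -> E s;
  (* the next three make the chain reach a final state, so that k has a change
     time and last_change_time is not the supremum of an empty set *)
  entered_rank : forall c s, step c s != s -> (rank s < rank (step c s))%N;
  entered_bound : forall s, (rank s <= bound)%N;
  entered_final : forall w, (forall c, step c (run s0 w) = run s0 w) ->
    E (run s0 w)
}.

Hypothesis ent : entered_by.
Hypothesis finite_rings : forall t, exists L, listing gap t L.

Local Notation runL s L := (foldl (fun s e => step e.1 s) s L).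

Let runLE s (L : seq (C * nat)) : runL s L = run s (map fst L).
Proof. by elim: L s => /=. Qed.

Let E_run s (L : seq (C * nat)) : E s -> E (runL s L).
Proof. by elim: L s => //= e L IH s Es; apply/IH/entered_stable. Qed.

Let rank_run s (L : seq (C * nat)) : (rank s <= rank (runL s L) ?= iff (s == runL s L))%N.
Proof.
elim: L s => [|e L IH] s /=; first by split; rewrite ?eqxx.
have [->|/(entered_rank ent) lts] := eqVneq (step e.1 s) s; first exact: IH.
have lt := leq_trans lts (IH _).1.
split; first exact: ltnW.
rewrite ltn_eqF//; apply/esym/negbTE/eqP => sE; by rewrite -sE ltnn in lt.
Qed.

Let late_ring c t : exists m, t <= ring (c, m).
Proof.
have [L [_ mL]] := finite_rings t; apply: contrapT => H.
have all m : (c, m) \in L by rewrite mL ltNge; apply/negP => tm; apply: H; exists m.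
have : uniq [seq (c, m) | m <- iota 0 (size L).+1].
  by rewrite map_inj_uniq ?iota_uniq// => ? ? [].
move=> us; have : {subset [seq (c, m) | m <- iota 0 (size L).+1] <= L}.
  by move=> _ /mapP[m _ ->].
by move=> /(uniq_leq_size us); rewrite size_map size_iota ltnn.
Qed.

(** While the state is outside E, some clock can change it. Once that clock has rung after t, the
    state has changed, by this ring or by an earlier one, and the bounded rank has grown. *)
Let eventually_E : exists t L, listing gap t L /\ E (runL s0 L).
Proof.
apply: contrapT => H.
have nE t L : listing gap t L -> ~~ E (runL s0 L).
  by move=> tL; apply/negP => EL; apply: H; exists t, L.
suff : forall n, exists t L, listing gap t L /\ (n <= rank (runL s0 L))%N.
  move=> /(_ bound.+1)[t [L [_]]].
  by apply/negP; rewrite -leqNgt (entered_bound ent).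
elim=> [|n [t [L [tL nL]]]]; first by have [L ?] := finite_rings 0; exists 0, L.
have [c sc] : exists c, step c (runL s0 L) != runL s0 L.
  apply: contrapT => nc; move/negP: (nE _ _ tL); apply.
  rewrite runLE; apply: (entered_final ent) => c; rewrite -runLE.
  by apply/eqP/negPn/negP => cn; apply: nc; exists c.
have [m tm] := late_ring c t.
have [L1 rL1] := finite_rings (ring (c, m)).
have [L2 tL2] := finite_rings (ring (c, m) + 1).
have r1 : ring (c, m) < ring (c, m) + 1 by rewrite ltrDl.
have [M L2E] := listing_rcons r1 rL1 tL2.
have [M1 L1E _] := listing_cat tm tL rL1.
exists (ring (c, m) + 1), L2; split => //.
rewrite L2E foldl_cat -cats1 foldl_cat /=.
apply: leq_trans (rank_run _ M).1.
have [e|ne] := eqVneq (runL s0 L) (runL s0 L1).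
  by rewrite -e; apply: leq_ltn_trans nL (entered_rank ent sc).
apply: leq_trans (rank_run _ [:: (c, m)]).1; apply: leq_ltn_trans nL _.
rewrite L1E foldl_cat; rewrite L1E foldl_cat in ne.
by rewrite ltn_neqAle (rank_run _ M1).2 ne (rank_run _ M1).1.
Qed.

(** E is entered at a ring e of k. This ring is a change, and k changes nothing later, since E is
    absorbing and fixed by k; so the supremum is the time of e. The state before t lies in E iff e
    precedes t. *)
Lemma last_change_time_lt t :
  (last_change_time step s0 gap k < t) = E (state_before step s0 gap t).
Proof.
have [t1 [L1 [tL1 EL1]]] := eventually_E.
have [L [e [M [L1E nEL ELe]]]] : exists L e M,
    [/\ L1 = L ++ e :: M, ~~ E (runL s0 L) & E (step e.1 (runL s0 L))].
  have := entered_init ent; elim: L1 s0 EL1 {tL1} => [|e L1 IH] s /=.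
    by move=> ->.
  have [Ese _ nEs|nEse EL1 _] := boolP (E (step e.1 s)).
    by exists [::], e, L1.
  by have [L [f [M [-> ? ?]]]] := IH _ EL1 nEse; exists (e :: L), f, M.
have ek : e.1 = k.
  by apply/eqP/negPn/negP => ek; move/negP: nEL; apply; apply: entered_through ELe.
have rL : listing gap (ring e) L by apply: (@listing_prefix _ _ _ t1 _ _ M); rewrite -L1E.
have stateE u : E (state_before step s0 gap u) = (ring e < u).
  have [Lu uLu] := finite_rings u; rewrite (state_before_listing _ _ uLu).
  apply/idP/idP => [|eu].
    apply: contraLR; rewrite -leNgt => ue.
    have [M' LE _] := listing_cat ue uLu rL.
    by apply: contra nEL; rewrite LE foldl_cat; exact: E_run.
  have [M' ->] := listing_rcons eu rL uLu.
  by rewrite foldl_cat -cats1 foldl_cat; exact: E_run.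
rewrite stateE; congr (_ < _).
rewrite /last_change_time; apply/eqP; rewrite eq_le; apply/andP; split.
  apply: ge_sup.
    exists (ring e), e.2; last by rewrite -ek -surjective_pairing.
    rewrite /= -ek -surjective_pairing.
    rewrite (state_before_listing _ _ rL); apply/eqP => sE.
    by rewrite sE (negPf nEL) in ELe.
  move=> _ [m /= sm <-]; rewrite leNgt -stateE; apply: contra sm => Em.
  by rewrite (entered_fixed ent).
apply: ub_le_sup.
  exists (ring e) => _ [m /= sm <-]; rewrite leNgt -stateE; apply: contra sm => Em.
  by rewrite (entered_fixed ent).
exists e.2; last by rewrite -ek -surjective_pairing.
rewrite /= -ek -surjective_pairing (state_before_listing _ _ rL); apply/eqP => sE.
by rewrite sE (negPf nEL) in ELe.
Qed.

End last_change.

(** * The law of the merged rings *)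

Section rings_of.
Context {C : finType}.

(** [k c] is the index of the next ring of c; a word of clocks becomes the list of the rings it
    stands for. *)
Fixpoint rings_of (k : C -> nat) (w : seq C) : seq (C * nat) :=
  if w is c :: w' then (c, k c) :: rings_of (fun x => (x == c) + k x)%N w'
  else [::].

Lemma mem_rings_of k w e :
  (e \in rings_of k w) = (k e.1 <= e.2 < k e.1 + count_mem e.1 w)%N.
Proof.
elim: w k e => [|c w IH] k [x m] /=.
  by rewrite addn0 in_nil; case: ltngtP.
rewrite inE IH xpair_eqE /= [m == k c]eq_sym (eq_sym c x).
by case: (eqVneq x c) => [->|_] /=; lia.
Qed.

Lemma map_fst_rings_of k w : map fst (rings_of k w) = w.
Proof. by elim: w k => //= c w IH k; rewrite IH. Qed.

(** The ways to spread the letters of w, in order, over l cells with at most one letter per cell. *)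
Fixpoint placements l (w : seq C) : seq (seq (option C)) :=
  if l is l'.+1 then
    [seq None :: p | p <- placements l' w] ++
    (if w is c :: w' then [seq Some c :: p | p <- placements l' w'] else [::])
  else if w is [::] then [:: [::]] else [::].

Lemma size_placements l w : size (placements l w) = 'C(l, size w).
Proof.
elim: l w => [|l IH] [|c w] //=; rewrite size_cat !size_map IH ?bin0 //=.
by rewrite IH binS.
Qed.

Lemma placements_uniq l w : uniq (placements l w).
Proof.
elim: l w => [|l IH] [|c w] //=; rewrite cat_uniq !map_inj_uniq ?IH //= ?andbT;
  try by move=> ? ? [].
by apply/hasPn => _ /mapP[p _ ->]; apply/negP => /mapP[].
Qed.

Lemma placementsP l w p : p \in placements l w -> size p = l /\ pmap id p = w.
Proof.
elim: l w p => [|l IH] w p /=; first by case: w => [|c w]; rewrite ?inE // => /eqP ->.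
rewrite mem_cat => /orP[/mapP[q /IH[<- <-] -> //]|].
by case: w => // c w /mapP[q /IH[<- <-] -> /=].
Qed.

End rings_of.

Section word_law.
Context {R : realType} d (T : measurableType d) (P : probability T R).
Context (C : finType) (gap : C -> nat -> {RV P >-> R}).
Hypothesis clocks : independent_poisson_clocks gap.

Local Notation ring := (ring_rv gap).
Local Notation ring_in := (ring_in gap).

Definition gaps_of w : C -> nat -> R := fun c m => gap c m w.

(** On this almost sure event the ring times of a clock are nondecreasing, so a lower bound on its
    next ring holds for all later ones. *)
Definition nonneg_gaps := [set w | forall c m, 0 <= gap c m w].

Lemma measurable_ring e : measurable_fun setT (ring e).
Proof. by case: e => c m; apply: measurable_sum => l. Qed.

Lemma measurable_ring_lt e t : measurable [set w | ring e w < t].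
Proof.
have -> : [set w | ring e w < t] = ring e @^-1` `]-oo, t[.
  by apply/seteqP; split => w /=; rewrite in_itv.
by rewrite -[X in measurable X]setTI; apply: measurable_ring.
Qed.

Lemma measurable_nonneg_gaps : measurable nonneg_gaps.
Proof.
have -> : nonneg_gaps = \bigcap_(c in [set: C]) \bigcap_m (gap c m @^-1` `[0, +oo[).
  apply/seteqP; split => w H.
    by move=> c _ m _; rewrite /= in_itv/= andbT; exact: H.
  by move=> c m; have := H c I m I; rewrite /= in_itv/= andbT.
apply: fin_bigcap_measurable => // c _; apply: bigcapT_measurable => m.
by rewrite -[X in measurable X]setTI; exact: measurable_funPT.
Qed.

Lemma nonneg_gaps1 : P nonneg_gaps = 1%E.
Proof.
have gap0 c m : P (~` (gap c m @^-1` `[0, +oo[)) = 0%E.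
  have mX A : measurable A -> measurable (gap c m @^-1` A).
    by move=> mA; rewrite -[X in measurable X]setTI; exact: measurable_funPT.
  have mg : measurable (gap c m @^-1` `[0, +oo[) by exact: mX.
  rewrite probability_setC//.
  suff -> : P (gap c m @^-1` `[0, +oo[) = 1%E by rewrite subee.
  apply/eqP; rewrite eq_le probability_le1//=.
  rewrite -(fineK (fin_num_measure P _ mg)) lee_fin.
  apply: (@ge_of_nat _ _ 1) => n.
  have := @exponential_interval _ _ _ P (gap c m) 0 n%:R (clocks.1 _ _) (lexx _).
  rewrite oppr0 expR0 => H; apply: le_trans; last (apply: le_trans; first exact: H).
    rewrite lerD2l lerN2 div1r expRN lef_pV2 ?posrE ?expR_gt0//.
    by apply: le_trans (expR_ge1Dx _); rewrite -natr1 addrC.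
  have mi : measurable (gap c m @^-1` [set x | 0 <= x < n%:R]).
    apply: mX; have -> : [set x : R | 0 <= x < n%:R] = `[0, n%:R[%classic.
      by apply/seteqP; split => g /=; rewrite in_itv.
    exact: measurable_itv.
  rewrite fine_le ?fin_num_measure// le_measure ?inE// => w /= /andP[].
  by rewrite in_itv/= => ->.
have mN := measurable_nonneg_gaps.
rewrite -[nonneg_gaps]setCK probability_setC; last exact: measurableC.
suff -> : P (~` nonneg_gaps) = 0%E by rewrite sube0.
apply/negligibleP; first exact: measurableC.
pose F i := if (choice.unpickle i : option (C * nat)) is Some e then ~` (gap e.1 e.2 @^-1` `[0, +oo[) else set0.
have [i|N [mN0 N0 FN]] := @negligible_bigcup _ _ _ P F.
  rewrite /F; case: (choice.unpickle i : option (C * nat)) => [[c m]|]; last exact: negligible_set0.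
  apply/negligibleP; last exact: gap0.
  by apply: measurableC; rewrite -[X in measurable X]setTI; exact: measurable_funPT.
exists N; split => // w /existsNP[c /existsNP[m H]]; apply: FN.
by exists (choice.pickle (c, m)) => //; rewrite /F choice.pickleK /= in_itv/= andbT.
Qed.

Lemma sum_disjoint_le (I : eqType) (s : seq I) (F : I -> set T) (H : set T) :
  uniq s -> (forall i, measurable (F i)) -> measurable H ->
  {in s &, forall i j w, F i w -> F j w -> i = j} ->
  {in s, forall i, F i `<=` H} ->
  \sum_(i <- s) fine (P (F i)) <= fine (P H).
Proof.
move=> + mF; elim: s H => [|i s IH] H /=; first by move=> *; rewrite big_nil fine_ge0.
move=> /andP[is_ us] mH disj sub; rewrite big_cons.
have mD : measurable (H `\` F i) by exact: measurableD.
have -> : P H = (P (F i) + P (H `\` F i))%E.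
  rewrite -measureU// ?setDIK// setDUK//.
  by apply: sub; rewrite mem_head.
rewrite fineD ?fin_num_measure// lerD2l; apply: IH => //.
  by move=> j k js ks; apply: disj; rewrite inE ?js ?ks orbT.
move=> j js w Fjw; split; first by apply: sub Fjw; rewrite inE js orbT.
move=> Fiw; move: is_; rewrite (disj i j _ _ w)// ?mem_head ?js//.
by rewrite inE js orbT.
Qed.

Lemma pattern_event_le c m s cells w : {in cells, forall x, 0 <= x.1} ->
  pattern_event gap c m s cells w -> s <= ring (c, m) w.
Proof.
elim: cells m s => [|[h []] cells IH] m s //= cells0; first by move=> [/andP[]].
have h0 : 0 <= h by apply: (cells0 (h, false)); rewrite mem_head.
move=> /IH; rewrite -subr_ge0 => H; rewrite -subr_ge0.
have -> : ring (c, m) w - s = ring (c, m) w - (s + h) + h by lra.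
by rewrite addr_ge0// H// => x xc; apply: cells0; rewrite inE xc orbT.
Qed.

Lemma joint_pattern_cons k s h o pat w : {in (h, o) :: pat, forall x, 0 <= x.1} ->
  joint_pattern gap k s ((h, o) :: pat) w <->
  (if o is Some c then ring_in (c, k c) s (s + h) w else True) /\
  joint_pattern gap (fun x => (Some x == o) + k x)%N (s + h) pat w.
Proof.
move=> pat0; split => [H|[H1 H2] c].
- split=> [|c]; last first.
    have := H c; rewrite /= eq_sym; case: eqP => [_ [_]|_] //.
  by case: o H pat0 => // c H _; have := H c; rewrite /= eqxx => -[].
- by have := H2 c; rewrite /= [Some c == o]eq_sym; case: eqP H1 => // ->.
Qed.

(** In the first cell where the patterns differ, one of them puts a ring that the other puts after
    the end of the cell. *)
Lemma joint_pattern_disjoint k s pat pat' w :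
  {in pat, forall x, 0 <= x.1} -> map fst pat = map fst pat' ->
  joint_pattern gap k s pat w -> joint_pattern gap k s pat' w -> pat = pat'.
Proof.
elim: pat pat' k s => [|[h o] pat IH] [|[h' o'] pat'] k s //= pat0 [<- patE].
have h0 : 0 <= h by apply: (pat0 (h, o)); rewrite mem_head.
have {}pat0' : {in pat, forall x, 0 <= x.1}.
  by move=> x xp; apply: pat0; rewrite inE xp orbT.
have pat'0 : {in pat', forall x, 0 <= x.1}.
  move=> x /(map_f fst); rewrite -patE => /mapP[y /pat0' y0 ->]; exact: y0.
have pc p q : {in p, forall x : R * option C, 0 <= x.1} -> {in (h, q) :: p, forall x, 0 <= x.1}.
  by move=> p0 x; rewrite inE => /predU1P[->|/p0].
have ge p q : {in p, forall x, 0 <= x.1} -> forall c, q != Some c ->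
    joint_pattern gap (fun x => (Some x == q) + k x)%N (s + h) p w -> s + h <= ring (c, k c) w.
  move=> p0 c qc /(_ c); rewrite eq_sym (negPf qc); apply: pattern_event_le.
  by move=> _ /mapP[x xp ->]; exact: p0.
move=> H1 H2; have [a1 j1] := (joint_pattern_cons _ _ _ (pc _ _ pat0')).1 H1.
have [a2 j2] := (joint_pattern_cons _ _ _ (pc _ _ pat'0)).1 H2.
have eo : o = o'.
  apply: contrapT => /eqP noo.
  case: o o' a1 a2 noo j1 j2 {pat0 H1 H2} => [c|] [c'|] //.
  - move=> _ /andP[_ lt] noo /ge ge1 _.
    by have := ge1 pat0' c' noo; rewrite leNgt lt.
  - move=> /andP[_ lt] _ noo _ /ge ge1; have := ge1 pat'0 c.
    by rewrite leNgt lt => /(_ isT).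
  - move=> _ /andP[_ lt] noo /ge ge1 _.
    by have := ge1 pat0' c' isT; rewrite leNgt lt.
by rewrite -eo in j2 *; rewrite (IH _ _ _ pat0' patE j1 j2).
Qed.

Definition pattern_word (pat : seq (R * option C)) := pmap snd pat.

Definition pattern_width (pat : seq (R * option C)) := \sum_(x <- pat) x.1.

(** The remainder [pat'] is kept so that the conclusion is available at every intermediate time of a
    history. *)
Lemma joint_pattern_rings k s pat pat' w :
  {in pat ++ pat', forall x, 0 <= x.1} -> joint_pattern gap k s (pat ++ pat') w ->
  [/\ sorted (fun e f => ring e w < ring f w) (rings_of k (pattern_word pat)),
      {in rings_of k (pattern_word pat), forall e, s <= ring e w < s + pattern_width pat} &
      forall c, s + pattern_width pat <= ring (c, (k c + count_mem c (pattern_word pat))%N) w].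
Proof.
elim: pat k s => [|[h o] pat IH] k s pat0.
  rewrite /pattern_width big_nil addr0 => H; split => //= c; rewrite addn0.
  by apply: pattern_event_le (H c) => _ /mapP[x xp ->]; exact: pat0.
have h0 : 0 <= h by apply: (pat0 (h, o)); rewrite mem_head.
move=> H1; have [ho] := (joint_pattern_cons _ _ _ pat0).1 H1.
have {}pat0 : {in pat ++ pat', forall x, 0 <= x.1}.
  by move=> x xp; apply: pat0; rewrite inE xp orbT.
have w0 : 0 <= pattern_width pat.
  by rewrite /pattern_width big_seq sumr_ge0// => x xp; apply: pat0; rewrite mem_cat xp.
move=> /(IH _ _ pat0); rewrite /pattern_width big_cons addrA => -[sL rL cL].
case: o ho sL rL cL {H1} => [c|] ho sL rL cL; last first.
  split => //= e /rL /andP[se es]; rewrite es andbT; apply: le_trans se; lra.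
have kE : (fun x : C => (Some x == Some c) + k x)%N = (fun x => (x == c) + k x)%N.
  by [].
rewrite kE in sL rL; move: ho => /andP[sc cs].
have tr : transitive (fun e f => ring e w < ring f w) by move=> ? ? ?; exact: lt_trans.
split.
- rewrite sorted_pairwise//= -sorted_pairwise// sL andbT.
  by apply/allP => e /rL /andP[se _]; exact: lt_le_trans se.
- move=> e; rewrite inE => /predU1P[->|/rL /andP[se es]]; apply/andP; split => //.
  + by apply: lt_le_trans cs _; rewrite lerDl.
  + by apply: le_trans se; rewrite lerDl.
- move=> x; have := cL x.
  have -> : (Some x == Some c) = (c == x) by rewrite eq_sym.
  by rewrite /= addnCA addnA.
Qed.

End word_law.

Section history.
Context {R : realType} d (T : measurableType d) (P : probability T R).
Context (C : finType) (gap : C -> nat -> {RV P >-> R}).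
Hypothesis clocks : independent_poisson_clocks gap.

Local Notation ring := (ring_rv gap).
Local Notation gaps_of := (gaps_of gap).

Definition word_before t W :=
  [set w | listing (gaps_of w) t (rings_of (fun=> 0%N) W)].

(** [tw] gives one width and one word per window. Rings are indexed from time 0, so each condition
    is stated for the whole word up to the end of the window. *)
Fixpoint history t W (tw : seq (R * seq C)) : set T :=
  if tw is (D, w) :: tw'
  then word_before (t + D) (W ++ w) `&` history (t + D) (W ++ w) tw'
  else setT.

Lemma measurable_ring_ltr e f : measurable [set w | ring e w < ring f w].
Proof.
have -> : [set w | ring e w < ring f w] =
    (fun w => ring e w - ring f w) @^-1` `]-oo, 0[.
  by apply/seteqP; split => w /=; rewrite in_itv/= subr_lt0.
rewrite -[X in measurable X]setTI.
have mf : measurable_fun setT (fun w => ring e w - ring f w).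
  by apply: measurable_funB; exact: measurable_ring.
exact: mf.
Qed.

Lemma measurable_eq_bool (b : bool) (A : set T) (p : T -> bool) :
  A = [set w | p w] -> measurable A -> measurable [set w | b = p w].
Proof.
move=> -> mA; case: b.
  by have -> : [set w | true = p w] = [set w | p w] by apply/seteqP; split => w /=.
have -> : [set w | false = p w] = ~` [set w | p w].
  by apply/seteqP; split => w /=; case: (p w).
exact: measurableC.
Qed.

Lemma measurable_word_before t W : measurable (word_before t W).
Proof.
set L := rings_of (fun=> 0%N) W.
have -> : word_before t W = [set w | pairwise (fun e f => ring e w < ring f w) L] `&`
    \bigcap_i (if (choice.unpickle i : option (C * nat)) is Some e
               then [set w | (e \in L) = (ring e w < t)] else setT).
  apply/seteqP; split => w.
    move=> [sL mL]; split.
      by rewrite /= -sorted_pairwise// => ? ? ?; exact: lt_trans.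
    by move=> i _; case: choice.unpickle => // e; exact: mL.
  move=> [pL mL]; split.
    by rewrite sorted_pairwise// => ? ? ?; exact: lt_trans.
  by move=> e; have := mL (choice.pickle e) I; rewrite choice.pickleK.
apply: measurableI.
  elim: L => [|e L IH] /=.
    by have -> : [set w : T | true] = setT by apply/seteqP.
  have -> : [set w | all (fun f => ring e w < ring f w) L && pairwise (fun e f => ring e w < ring f w) L] =
      [set w | all (fun f => ring e w < ring f w) L] `&` [set w | pairwise (fun e f => ring e w < ring f w) L].
    by apply/seteqP; split=> w /andP.
  apply: measurableI IH.
  elim: L => [|f L IH] /=.
    by have -> : [set w : T | true] = setT by apply/seteqP.
  have -> : [set w | (ring e w < ring f w) && all (fun f => ring e w < ring f w) L] =
      [set w | ring e w < ring f w] `&` [set w | all (fun f => ring e w < ring f w) L].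
    by apply/seteqP; split=> w /andP.
  by apply: measurableI IH; exact: measurable_ring_ltr.
apply: bigcapT_measurable => i; case: choice.unpickle => [e|//].
exact: measurable_eq_bool (measurable_ring_lt _ _ _).
Qed.

Lemma measurable_history t W tw : measurable (history t W tw).
Proof.
elim: tw t W => [|[D w] tw IH] t W //=.
by apply: measurableI => //; exact: measurable_word_before.
Qed.

Lemma word_before_uniq t W W' w : word_before t W w -> word_before t W' w -> W = W'.
Proof.
move=> H H'; rewrite -[W](map_fst_rings_of (fun=> 0%N)) (listing_uniq H H').
exact: map_fst_rings_of.
Qed.

Fixpoint cell_patterns l (tw : seq (R * seq C)) : seq (seq (R * option C)) :=
  if tw is (D, w) :: tw' then
    [seq [seq (D / l%:R, o) | o <- p] ++ q | p <- placements l w, q <- cell_patterns l tw']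
  else [:: [::]].

Lemma listing_pattern pat pat' w : {in pat ++ pat', forall x, 0 <= x.1} ->
  joint_pattern gap (fun=> 0%N) 0 (pat ++ pat') w -> nonneg_gaps gap w ->
  word_before (pattern_width pat) (pattern_word pat) w.
Proof.
move=> pat0 /(joint_pattern_rings pat0)[]; rewrite add0r => sL rL cL w0.
split=> // -[c m]; rewrite mem_rings_of /= add0n.
case: ltnP => [mc|cm]; last first.
  apply/esym/negbTE; rewrite -leNgt; apply: le_trans (cL c) _; rewrite add0n.
  elim: m cm => [|m IH]; first by rewrite leqn0 => /eqP ->.
  rewrite leq_eqVlt => /predU1P[->//|/IH H].
  apply: le_trans H _; rewrite -/(ring (c, m) w) -/(ring (c, m.+1) w) ringS lerDl.
  exact: w0.
apply/esym; have := rL (c, m); rewrite mem_rings_of /= add0n mc => /(_ isT).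
by case/andP.
Qed.

Definition widths_ge0 (tw : seq (R * seq C)) := {in tw, forall x, 0 <= x.1}.

Lemma cell_patterns_ge0 l tw pat : widths_ge0 tw -> pat \in cell_patterns l tw ->
  {in pat, forall x, 0 <= x.1}.
Proof.
elim: tw pat => [|[D w] tw IH] pat tw0; first by rewrite inE => /eqP ->.
have D0 : 0 <= D by apply: (tw0 (D, w)); rewrite mem_head.
move=> /allpairsP[[p q] [_ /= /IH qtw ->]] x; rewrite mem_cat => /orP[/mapP[v _ ->]|].
  by rewrite divr_ge0.
by apply: qtw => y ytw; apply: tw0; rewrite inE ytw orbT.
Qed.

Lemma pattern_history l tw pat0 pat w : (0 < l)%N -> widths_ge0 tw ->
  {in pat0, forall x, 0 <= x.1} -> pat \in cell_patterns l tw ->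
  joint_pattern gap (fun=> 0%N) 0 (pat0 ++ pat) w -> nonneg_gaps gap w ->
  history (pattern_width pat0) (pattern_word pat0) tw w.
Proof.
move=> l0; elim: tw pat0 pat => [//|[D wd] tw IH] pat0 pat tw0 pat00 pattw Hpat w0.
have pat1 := cell_patterns_ge0 tw0 pattw.
move: pattw => /allpairsP[[p q] [/= ppl qtw patE]].
have [sp pw] := placementsP ppl.
set b := [seq (D / l%:R, o) | o <- p] in patE.
have bw : pattern_width b = D.
  rewrite /pattern_width big_map big_const_seq count_predT sp iter_addr addr0.
  by rewrite -[_ *+ _]mulr_natr divfK// pnatr_eq0 -lt0n.
have bW : pattern_word b = wd.
  by rewrite /pattern_word /b -pw; elim: (p) => //= -[c|] p' ->.
have wE : pattern_width pat0 + D = pattern_width (pat0 ++ b).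
  by rewrite -bw /pattern_width big_cat.
have WE : pattern_word pat0 ++ wd = pattern_word (pat0 ++ b).
  by rewrite -bW /pattern_word pmap_cat.
rewrite patE catA in Hpat; rewrite patE in pat1.
have pat2 : {in (pat0 ++ b) ++ q, forall x, 0 <= x.1}.
  by rewrite -catA => x; rewrite mem_cat => /orP[/pat00|/pat1].
rewrite /= wE WE; split; first exact: listing_pattern Hpat w0.
apply: IH qtw Hpat w0.
  by move=> x xtw; apply: tw0; rewrite inE xtw orbT.
by move=> x xb; apply: pat2; rewrite mem_cat xb.
Qed.

Definition poisson_weight D a : R := expR (- (#|C|%:R * D)) * D ^+ a / a`!%:R.

Lemma cell_patterns_weight l tw : (0 < l)%N ->
  \sum_(pat <- cell_patterns l tw) \prod_(x <- pat)
    (expR (- (#|C|%:R * x.1)) * (if isSome x.2 then x.1 else 1)) =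
  \prod_(x <- tw) ('C(l, size x.2)%:R * (expR (- (#|C|%:R * x.1)) *
    (x.1 / l%:R) ^+ size x.2)).
Proof.
move=> l0; elim: tw => [|[D w] tw IH]; first by rewrite big_seq1 !big_nil.
rewrite /= big_allpairs_dep big_cons /= -IH.
under eq_bigr do under eq_bigr do rewrite big_cat.
under eq_bigr do rewrite -big_distrr /=.
rewrite -big_distrl /=; congr (_ * _).
rewrite -size_placements big_seq.
rewrite (eq_bigr (fun=> expR (- (#|C|%:R * D)) * (D / l%:R) ^+ size w)); last first.
  move=> p /placementsP[pl <-]; rewrite big_map big_split/= big_const_seq.
  rewrite count_predT pl iter_mulr mulr1 -expRM_natl; congr (expR _ * _).
    by rewrite mulrN; congr (- _); field; rewrite pnatr_eq0 -lt0n.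
  elim: p {pl} => [|[c|] p IHp]; rewrite ?big_nil ?expr0// big_cons/= IHp.
    by rewrite exprS.
  by rewrite mul1r.
rewrite -big_seq big_const_seq count_predT iter_addr addr0.
by rewrite [RHS]mulr_natl.
Qed.

Lemma cell_patterns_uniq l tw : uniq (cell_patterns l tw).
Proof.
elim: tw => [|[D w] tw IH] //=; apply: allpairs_uniq => //.
  exact: placements_uniq.
move=> [p q] [p' q'] /allpairsP[[p1 q1] [/= p1l _ [-> ->]]].
move=> /allpairsP[[p2 q2] [/= p2l _ [-> ->]]] /eqP.
rewrite eqseq_cat; last first.
  by rewrite !size_map (placementsP p1l).1 (placementsP p2l).1.
have inj : injective (fun v : option C => (D / l%:R, v)) by move=> ? ? [].
by move=> /andP[/eqP/(inj_map inj) -> /eqP ->].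
Qed.

Lemma cell_patterns_widths l tw pat : pat \in cell_patterns l tw ->
  map fst pat = flatten [seq nseq l (x.1 / l%:R) | x <- tw].
Proof.
elim: tw pat => [|[D w] tw IH] pat; first by rewrite inE => /eqP ->.
move=> /allpairsP[[p q] [/= /placementsP[pl _] /IH qtw ->]].
rewrite map_cat qtw -map_comp; congr (_ ++ _).
by rewrite -[in nseq l]pl; elim: (p) => //= v p' ->.
Qed.

Lemma binomial_ratio_cvg a :
  ('C(l, a)%:R / l%:R ^+ a : R) @[l --> \oo] --> (a`!%:R^-1 : R).
Proof.
have H0 b : ((l.+1 - b)%:R / l.+1%:R : R) @[l --> \oo] --> (1 : R).
  have : (1 - b%:R * l.+1%:R^-1 : R) @[l --> \oo] --> (1 - b%:R * 0 : R).
    apply: cvgB; first exact: cvg_cst.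
    by apply: cvgM; [exact: cvg_cst|exact: cvg_harmonic].
  rewrite mulr0 subr0; apply: cvg_trans; apply: near_eq_cvg.
  exists b => // l /= bl; rewrite natrB; last exact: leqW.
  by rewrite mulrBl divff// pnatr_eq0.
have H1 : ((l.+1 ^_ a)%:R / l.+1%:R ^+ a : R) @[l --> \oo] --> (1 : R).
  elim: a => [|a IH].
    by under eq_fun do rewrite ffactn0 expr0 divr1; exact: cvg_cst.
  have E l : (l.+1 ^_ a.+1)%:R / l.+1%:R ^+ a.+1 =
      (l.+1 ^_ a)%:R / l.+1%:R ^+ a * ((l.+1 - a)%:R / l.+1%:R) :> R.
    by rewrite ffactnSr natrM exprSr invfM; ring.
  under eq_fun do rewrite E.
  have K : ((l.+1 ^_ a)%:R / l.+1%:R ^+ a * ((l.+1 - a)%:R / l.+1%:R) : R)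
      @[l --> \oo] --> (1 * 1 : R) by exact: cvgM IH (H0 a).
  by rewrite mulr1 in K.
have E l : 'C(l.+1, a)%:R / l.+1%:R ^+ a =
    (l.+1 ^_ a)%:R / l.+1%:R ^+ a * a`!%:R^-1 :> R.
  by rewrite -bin_ffact natrM mulrAC mulfK// pnatr_eq0 -lt0n fact_gt0.
rewrite -cvg_shiftS; under eq_fun do rewrite E.
have K : ((l.+1 ^_ a)%:R / l.+1%:R ^+ a * a`!%:R^-1 : R) @[l --> \oo] --> (1 * a`!%:R^-1 : R).
  by apply: cvgM H1 _; exact: cvg_cst.
by rewrite mul1r in K.
Qed.

Lemma probability_setI1 A B : measurable A -> measurable B -> P B = 1%E ->
  P (A `&` B) = P A.
Proof.
move=> mA mB B1; rewrite [RHS](measureDI P (B := B))//.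
rewrite [X in (X + _)%E](_ : _ = 0%E) ?add0e//; apply/eqP; rewrite -measure_le0.
have -> : 0%E = P (~` B) by rewrite probability_setC// B1 subee.
by rewrite le_measure ?inE//; [exact: measurableD|exact: measurableC].
Qed.

(** With l cells per window, the patterns compatible with [tw] are disjoint events inside the
    history, once negative gaps are excluded. A window of width D with a word of length a
    contributes at least ['C(l, a)] times (D / l)^a exp(-ND), where N is the number of clocks; then
    l tends to infinity. *)
Lemma history_ge tw : widths_ge0 tw ->
  \prod_(x <- tw) poisson_weight x.1 (size x.2) <= fine (P (history 0 [::] tw)).
Proof.
move=> tw0.
have cell_le l : (0 < l)%N -> \prod_(x <- tw) ('C(l, size x.2)%:R *
    (expR (- (#|C|%:R * x.1)) * (x.1 / l%:R) ^+ size x.2)) <=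
    fine (P (history 0 [::] tw)).
  move=> l0; rewrite -cell_patterns_weight//.
  pose F pat := joint_pattern gap (fun=> 0%N) 0 pat `&` nonneg_gaps gap.
  have mj pat : measurable (joint_pattern gap (fun=> 0%N) 0 pat).
    have -> : joint_pattern gap (fun=> 0%N) 0 pat =
        \bigcap_(c in [set: C]) pattern_event gap c 0 0 (cells_of pat c).
      by apply/seteqP; split => w H c; [move=> _|apply: H].
    by apply: fin_bigcap_measurable => // c _; exact: pattern_event_measurable.
  have mN := measurable_nonneg_gaps gap.
  have FE pat : P (F pat) = P (joint_pattern gap (fun=> 0%N) 0 pat).
    exact: probability_setI1 (mj pat) mN (nonneg_gaps1 clocks).
  have := @sum_disjoint_le _ _ _ P _ _ F (history 0 [::] tw) (cell_patterns_uniq l tw).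
  move=> S; apply: le_trans (S _ _ _ _).
  - rewrite big_seq [leRHS]big_seq; apply: ler_sum => pat pattw; rewrite FE.
    by apply: joint_pattern_ge => //; exact: cell_patterns_ge0 pattw.
  - by move=> pat; exact: measurableI.
  - exact: measurable_history.
  - move=> p q ptw qtw w [jp _] [jq _].
    apply: joint_pattern_disjoint jp jq; first exact: cell_patterns_ge0 ptw.
    by rewrite (cell_patterns_widths ptw) (cell_patterns_widths qtw).
  - move=> p ptw w [jp w0].
    have := pattern_history (pat0 := [::]) l0 tw0 _ ptw jp w0.
    by rewrite /pattern_width big_nil; apply.
have : (\prod_(x <- tw) ('C(l, size x.2)%:R * (expR (- (#|C|%:R * x.1)) *
    (x.1 / l%:R) ^+ size x.2)) : R) @[l --> \oo] -->
    \prod_(x <- tw) poisson_weight x.1 (size x.2).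
  elim: tw {tw0 cell_le} => [|[D w] tw IH].
    by under eq_fun do rewrite big_nil; rewrite big_nil; exact: cvg_cst.
  under eq_fun do rewrite big_cons.
  rewrite big_cons; apply: cvgM IH => /=.
  have E l : 'C(l, size w)%:R * (expR (- (#|C|%:R * D)) * (D / l%:R) ^+ size w) =
     expR (- (#|C|%:R * D)) * D ^+ size w * ('C(l, size w)%:R / l%:R ^+ size w) :> R.
    by rewrite expr_div_n; ring.
  under eq_fun do rewrite E.
  by apply: cvgM; [exact: cvg_cst|exact: binomial_ratio_cvg].
move=> cvgw; apply: (closed_cvg (fun x : R => x <= fine (P (history 0 [::] tw))) _ _ _ cvgw).
  exact: closed_le.
by exists 1%N => // l l1; exact: cell_le.
Qed.

End history.

Section words.
Context {C : finType}.

Fixpoint words a : seq (seq C) :=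
  if a is a'.+1 then [seq c :: w | c <- enum C, w <- words a'] else [:: [::]].

Definition words_upto l := flatten [seq words a | a <- iota 0 l].

Lemma mem_words a w : (w \in words a) = (size w == a).
Proof.
elim: a w => [|a IH] w; first by rewrite inE; case: w.
apply/allpairsP/eqP => [[[c v] [_ /= + ->]]|]; first by rewrite IH => /eqP <-.
by case: w => // c v [va]; exists (c, v); rewrite /= mem_enum IH va.
Qed.

Lemma words_uniq a : uniq (words a).
Proof.
elim: a => // a IH; apply: allpairs_uniq => //; first exact: enum_uniq.
by move=> [c v] [c' v'] _ _ [-> ->].
Qed.

Lemma words_upto_uniq l : uniq (words_upto l).
Proof.
suff H m : uniq (flatten [seq words a | a <- iota m l]) by exact: H.
elim: l m => [|l IH] m //=; rewrite cat_uniq words_uniq IH andbT /=.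
apply/hasPn => w /flattenP[_ /mapP[a + ->]].
by rewrite !mem_words mem_iota => /andP[ma _] /eqP wa; rewrite neq_ltn wa ma orbT.
Qed.

End words.

(** * Poissonized semigroups and the joint law of last change times *)

Section flow.
Context {R : realType} {C : finType} {S : Type}.
Variable step : C -> S -> S.

Local Notation run := (foldl (fun s c => step c s)).

(** The generator Q of the chain also subtracts [#|C|%:R * f s]. That term is the exponential factor
    of [poisson_weight], so that [flow D] is exp(DQ). *)
Definition generator (f : S -> R) s := \sum_c f (step c s).

Definition flow_sum D (f : S -> R) s l :=
  \sum_(a < l) poisson_weight C D a * iter a generator f s.

Definition flow D f s := limn (flow_sum D f s).

Lemma generator_words a f s : iter a generator f s = \sum_(w <- words a) f (run s w).
Proof.
elim: a s => [|a IH] s; first by rewrite big_seq1.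
by rewrite iterS /generator big_allpairs_dep/= big_enum/=; apply: eq_bigr => c _; exact: IH.
Qed.

Lemma poisson_weight_ge0 D a : 0 <= D -> 0 <= poisson_weight C D a :> R.
Proof. by move=> D0; rewrite !mulr_ge0 ?expR_ge0 ?exprn_ge0 ?invr_ge0. Qed.

Lemma flow_sum_words D f s l :
  flow_sum D f s l = \sum_(w <- words_upto l) poisson_weight C D (size w) * f (run s w).
Proof.
rewrite /flow_sum /words_upto big_flatten big_map -[l in iota 0 l]subn0 -/(index_iota 0 l).
rewrite big_mkord; apply: eq_bigr => a _; rewrite generator_words mulr_sumr.
by rewrite big_seq [RHS]big_seq; apply: eq_bigr => w; rewrite mem_words => /eqP ->.
Qed.

Lemma flow_sum1_cvg D s : flow_sum D (fun=> 1) s @ \oo --> (1 : R).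
Proof.
have E l : flow_sum D (fun=> 1) s l = expR (- (#|C|%:R * D)) * series (exp_coeff (#|C|%:R * D)) l.
  rewrite /flow_sum /series/= mulr_sumr big_mkord; apply: eq_bigr => a _.
  have -> : iter a generator (fun=> 1) s = #|C|%:R ^+ a.
    elim: (val a) s => [|k IH] s //; rewrite iterS /generator.
    by under eq_bigr do rewrite IH; rewrite sumr_const exprS mulr_natl.
  by rewrite /poisson_weight /exp_coeff/= exprMn; ring.
have -> : flow_sum D (fun=> 1) s = (fun l => expR (- (#|C|%:R * D)) * series (exp_coeff (#|C|%:R * D)) l).
  by apply/funext => l; exact: E.
have K : (fun l => expR (- (#|C|%:R * D)) * series (exp_coeff (#|C|%:R * D)) l) @ \oo -->
    expR (- (#|C|%:R * D)) * expR (#|C|%:R * D).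
  by apply: cvgM; [exact: cvg_cst|exact: is_cvg_series_exp_coeff].
have e1 : expR (- (#|C|%:R * D)) * expR (#|C|%:R * D) = 1.
  by rewrite expRN mulVf ?gt_eqF ?expR_gt0.
by rewrite e1 in K.
Qed.

Definition unit_valued (f : S -> R) := forall s, 0 <= f s <= 1.

Lemma flow_sum_le D f s l : 0 <= D -> unit_valued f ->
  0 <= flow_sum D f s l <= flow_sum D (fun=> 1) s l.
Proof.
move=> D0 f01; rewrite !flow_sum_words; apply/andP; split.
  by apply: sumr_ge0 => w _; rewrite mulr_ge0 ?poisson_weight_ge0//; case/andP: (f01 (run s w)).
by apply: ler_sum => w _; rewrite ler_wpM2l ?poisson_weight_ge0//; case/andP: (f01 (run s w)).
Qed.

Lemma flow_sum_nondecreasing D f s : 0 <= D -> unit_valued f ->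
  nondecreasing_seq (flow_sum D f s).
Proof.
move=> D0 f01; apply/nondecreasing_seqP => l; rewrite /flow_sum big_ord_recr/= lerDl.
rewrite generator_words mulr_ge0 ?poisson_weight_ge0// sumr_ge0// => w _.
by case/andP: (f01 (run s w)).
Qed.

Lemma flow_sum1_le D s l : 0 <= D -> flow_sum D (fun=> 1) s l <= 1.
Proof.
move=> D0; rewrite -[leRHS](cvg_lim _ (@flow_sum1_cvg D s))//.
apply: nondecreasing_cvgn_le; last by apply/cvg_ex; exists 1; exact: flow_sum1_cvg.
by apply: flow_sum_nondecreasing => // ?; rewrite ler01 lexx.
Qed.

Lemma flow_cvg D f s : 0 <= D -> unit_valued f -> flow_sum D f s @ \oo --> flow D f s.
Proof.
move=> D0 f01; apply: nondecreasing_is_cvgn; first exact: flow_sum_nondecreasing.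
exists 1 => _ [l _ <-]; case/andP: (flow_sum_le s l D0 f01) => _ /le_trans; apply.
exact: flow_sum1_le.
Qed.

Lemma flow_unit_valued D f : 0 <= D -> unit_valued f -> unit_valued (flow D f).
Proof.
move=> D0 f01 s; apply/andP; split.
  apply: limr_ge; first by apply/cvg_ex; eexists; exact: flow_cvg.
  by apply: nearW => l; case/andP: (flow_sum_le s l D0 f01).
apply: limr_le; first by apply/cvg_ex; eexists; exact: flow_cvg.
apply: nearW => l; case/andP: (flow_sum_le s l D0 f01) => _ /le_trans; apply.
exact: flow_sum1_le.
Qed.

End flow.

Section markov.
Context {R : realType} d (T : measurableType d) (P : probability T R).
Context (C : finType) (gap : C -> nat -> {RV P >-> R}).
Hypothesis clocks : independent_poisson_clocks gap.

Local Notation gaps_of := (gaps_of gap).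
Local Notation history := (history gap).
Local Notation word_before := (word_before gap).

Definition history_end (tw : seq (R * seq C)) := \sum_(x <- tw) x.1.

Definition history_word (tw : seq (R * seq C)) := flatten (map snd tw).

Definition history_weight (tw : seq (R * seq C)) : R :=
  \prod_(x <- tw) poisson_weight C x.1 (size x.2).

Lemma history_rcons t W tw D w : history t W (rcons tw (D, w)) =
  history t W tw `&` word_before (t + history_end tw + D) (W ++ history_word tw ++ w).
Proof.
elim: tw t W => [|[D' w'] tw IH] t W /=.
  by rewrite /history_end big_nil addr0 setIT setTI.
by rewrite IH setIA /history_end big_cons addrA /history_word /= -!catA.
Qed.

Lemma history_disjoint tw D w w' o : history 0 [::] (rcons tw (D, w)) o ->
  history 0 [::] (rcons tw (D, w')) o -> w = w'.
Proof.
rewrite !history_rcons => -[_ H] [_ H']; have := word_before_uniq H H'.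
by move=> /eqP; rewrite !eqseq_cat// !eqxx/= => /eqP.
Qed.

Lemma history_weight_ge0 tw : widths_ge0 tw -> 0 <= history_weight tw.
Proof.
move=> tw0; rewrite /history_weight big_seq; apply: prodr_ge0 => x xtw.
exact/poisson_weight_ge0/tw0.
Qed.

(* The lower bounds history_ge add up to 1 over all words, so they are
   equalities. *)
Lemma history_eq tw : widths_ge0 tw ->
  fine (P (history 0 [::] tw)) = history_weight tw.
Proof.
elim/last_ind: tw => [|tw [D w] IH] tw0.
  by rewrite /history_weight big_nil/= probability_setT.
have D0 : 0 <= D by apply: (tw0 (D, w)); rewrite mem_rcons mem_head.
have {}tw0 : widths_ge0 tw.
  by move=> x xtw; apply: tw0; rewrite mem_rcons inE xtw orbT.
have q0 := history_weight_ge0 tw0.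
have weight_rcons v : history_weight (rcons tw (D, v)) =
    history_weight tw * poisson_weight C D (size v).
  by rewrite /history_weight -cats1 big_cat big_seq1.
have ge v : history_weight tw * poisson_weight C D (size v) <=
    fine (P (history 0 [::] (rcons tw (D, v)))).
  rewrite -weight_rcons; apply: history_ge => // x.
  by rewrite mem_rcons inE => /predU1P[->|/tw0].
apply/eqP; rewrite eq_le; apply/andP; split; last by rewrite weight_rcons.
rewrite weight_rcons.
set p := fine _; set q := history_weight tw in q0 ge *.
(* For the chain with one state this is the total weight of the words shorter than l, which tends to
   1. *)
pose u l := flow_sum (fun (c : C) (s : unit) => s) D (fun=> 1) tt l.
have le l : (size w < l)%N -> p <= q * poisson_weight C D (size w) + q * (1 - u l).
  move=> wl; have wW : w \in words_upto l.
    apply/flattenP; exists (words (size w)); last by rewrite mem_words.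
    by apply: map_f; rewrite mem_iota.
  have := @sum_disjoint_le _ _ _ P _ (words_upto l)
    (fun v => history 0 [::] (rcons tw (D, v))) (history 0 [::] tw)
    (words_upto_uniq l) (fun _ => measurable_history _ _ _ _) (measurable_history _ _ _ _).
  move=> /(_ _ _); rewrite IH// => H.
  have {H} : p + \sum_(v <- words_upto l | v != w) q * poisson_weight C D (size v) <= q.
    apply: le_trans (H _ _); last 2 first.
    - by move=> v v' _ _ o; exact: history_disjoint.
    - by move=> v _ o; rewrite history_rcons => -[].
    rewrite (bigD1_seq w)//= ?words_upto_uniq// lerD2l.
    by apply: ler_sum => v _; exact: ge.
  have -> : u l = poisson_weight C D (size w) + \sum_(v <- words_upto l | v != w) poisson_weight C D (size v).
    rewrite /u flow_sum_words (bigD1_seq w)//= ?words_upto_uniq// mulr1; congr (_ + _).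
    by apply: eq_bigr => v _; rewrite mulr1.
  by rewrite -mulr_sumr; lra.
have : (q * poisson_weight C D (size w) + q * (1 - u l)) @[l --> \oo] -->
    q * poisson_weight C D (size w) + q * (1 - 1).
  apply: cvgD; first exact: cvg_cst.
  apply: cvgM; first exact: cvg_cst.
  by apply: cvgB; [exact: cvg_cst|exact: flow_sum1_cvg].
rewrite subrr mulr0 addr0 => cvgu.
apply: (closed_cvg (fun x : R => p <= x) _ _ _ cvgu); first exact: closed_ge.
by exists (size w).+1 => // l /= wl; exact: le.
Qed.

(** Integer times suffice, since a listing restricts to all earlier times; being countably many,
    they give an event of probability 1. *)
Definition regular := \bigcap_n \bigcup_(w in [set: seq C]) word_before n%:R w.

Lemma measurable_all_words t : measurable (\bigcup_(w in [set: seq C]) word_before t w).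
Proof.
rewrite (_ : \bigcup_(w in _) _ =
    \bigcup_i (if (choice.unpickle i : option (seq C)) is Some w then word_before t w else set0)).
  apply: bigcupT_measurable => i.
  by case: (choice.unpickle i : option (seq C)) => [w|//]; exact: measurable_word_before.
apply/seteqP; split => o [i _].
  by move=> H; exists (choice.pickle i) => //; rewrite choice.pickleK.
by case: (choice.unpickle i : option (seq C)) => [w|//] H; exists w.
Qed.

Lemma measurable_regular : measurable regular.
Proof. by apply: bigcapT_measurable => n; exact: measurable_all_words. Qed.

Lemma regular1 : P regular = 1%E.
Proof.
have mW n : measurable (\bigcup_(w in [set: seq C]) word_before n%:R w).
  exact: measurable_all_words.
have H n : P (~` \bigcup_(w in [set: seq C]) word_before n%:R w) = 0%E.
  rewrite probability_setC; last exact: mW.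
  set Q := \bigcup_(w in _) _ in mW *.
  suff -> : P Q = 1%E by rewrite subee.
  apply/eqP; rewrite eq_le probability_le1/=; last exact: mW.
  rewrite -(fineK (fin_num_measure P _ (mW n))) lee_fin.
  pose u l := flow_sum (fun (c : C) (s : unit) => s) n%:R (fun=> 1) tt l.
  apply: (closed_cvg (fun x : R => x <= fine (P Q)) _ _ _
    (flow_sum1_cvg (fun (c : C) (s : unit) => s) n%:R tt)); first exact: closed_le.
  apply: nearW => l; rewrite flow_sum_words.
  have WE w : fine (P (word_before n%:R w)) = poisson_weight C n%:R (size w).
    have := @history_eq [:: (n%:R, w)]; rewrite /history_weight big_seq1/= setIT add0r.
    by apply=> x; rewrite inE => /eqP ->.
  under eq_bigr do rewrite mulr1 -WE.
  apply: (@sum_disjoint_le _ _ _ P _ (words_upto l) (word_before n%:R) Q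
    (words_upto_uniq l) (fun w => measurable_word_before _ _ _) (mW n)).
  - by move=> w w' _ _ o Fw Fw'; exact: word_before_uniq Fw Fw'.
  - by move=> w _ o Fw; exists w.
rewrite -[regular]setCK probability_setC; last exact/measurableC/measurable_regular.
suff -> : P (~` regular) = 0%E by rewrite sube0.
apply: measure_negligible; first exact/measurableC/measurable_regular.
rewrite /regular setC_bigcap; apply: negligible_bigcup => n.
by apply/negligibleP; [exact/measurableC/mW|exact: H].
Qed.

Lemma regular_listing w : regular w -> forall t, exists L, listing (gaps_of w) t L.
Proof.
move=> reg t; have [n tn] : exists n : nat, t <= n%:R.
  exists (Num.trunc t).+1; apply/ltW; exact: truncnS_gt.
have [W _ H] := reg n I; exists [seq e <- rings_of (fun=> 0%N) W | ring_time (gaps_of w) e < t].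
exact: listing_le H.
Qed.

Context (S : eqType) (step : C -> S -> S) (s0 : S).
Context (m : nat) (k : 'I_m -> C) (E : 'I_m -> pred S) (rank : S -> nat) (bound : nat).
Hypothesis ent : forall i, entered_by step s0 (k i) (E i) rank bound.

Let U i w := last_change_time step s0 (gaps_of w) (k i).

Hypothesis measurable_U : forall i, measurable_fun setT (U i).

Local Notation run := (foldl (fun s c => step c s)).

(** Each index in [ev] comes with the time elapsed since the previous condition, so that the
    conditions are tested one window after another. *)
Fixpoint later t (ev : seq (R * 'I_m)) : set T :=
  if ev is (D, i) :: ev' then [set w | U i w < t + D] `&` later (t + D) ev'
  else setT.

Fixpoint value (ev : seq (R * 'I_m)) : S -> R :=
  if ev is (D, i) :: ev' then flow step D (fun s => (E i s)%:R * value ev' s)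
  else fun=> 1.

Lemma measurable_later t ev : measurable (later t ev).
Proof.
elim: ev t => [|[D i] ev IH] t //=; apply: measurableI => //.
have -> : [set w | U i w < t + D] = U i @^-1` `]-oo, (t + D)[.
  by apply/seteqP; split => w /=; rewrite in_itv.
by rewrite -[X in measurable X]setTI; exact: measurable_U.
Qed.

Lemma indicator_unit_valued (p : pred S) f :
  unit_valued f -> unit_valued (fun s => (p s)%:R * f s : R).
Proof.
move=> f01 s; have /andP[v0 v1] := f01 s.
by case: (p s); rewrite ?mul1r ?mul0r ?v0 ?v1// lexx ler01.
Qed.

Lemma value_unit_valued ev : {in ev, forall x, 0 <= x.1} -> unit_valued (value ev).
Proof.
elim: ev => [|[D i] ev IH] ev0 /=; first by move=> s; rewrite ler01 lexx.
apply: flow_unit_valued; first by apply: (ev0 (D, i)); rewrite mem_head.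
apply/indicator_unit_valued/IH => x xe.
by apply: ev0; rewrite inE xe orbT.
Qed.

(** This is the Markov property, by splitting over the word w of the next window. Given w, the state
    at its end is [run s w], which decides the first condition through [E i]; the others are the
    induction hypothesis for the longer history. *)
Lemma later_value tw ev : widths_ge0 tw -> {in ev, forall x, 0 <= x.1} ->
  fine (P (history 0 [::] tw `&` later (history_end tw) ev)) =
  history_weight tw * value ev (run s0 (history_word tw)).
Proof.
elim: ev tw => [|[D i] ev IH] tw tw0 ev0.
  by rewrite /= setIT mulr1; exact: history_eq.
have D0 : 0 <= D by apply: (ev0 (D, i)); rewrite mem_head.
have {}ev0 : {in ev, forall x, 0 <= x.1}.
  by move=> x xe; apply: ev0; rewrite inE xe orbT.
set B := _ `&` _; set H := history 0 [::] tw in B *.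
set q := history_weight tw; set s := run s0 (history_word tw).
pose F w := history 0 [::] (rcons tw (D, w)).
have tw0' w : widths_ge0 (rcons tw (D, w)).
  by move=> x; rewrite mem_rcons inE => /predU1P[->|/tw0].
pose f s' := (E i s')%:R * value ev s'.
have f01 : unit_valued f.
  by apply: indicator_unit_valued; exact: value_unit_valued.
have mB : measurable B by apply: measurableI; [exact: measurable_history|exact: measurable_later].
have FE w : fine (P (F w)) = q * poisson_weight C D (size w).
  by rewrite history_eq// /history_weight -cats1 big_cat big_seq1.
have mF w : measurable (F w) by exact: measurable_history.
have FH w : F w `<=` H by move=> o; rewrite /F history_rcons => -[].
have endE w : history_end (rcons tw (D, w)) = history_end tw + D.
  by rewrite /history_end -cats1 big_cat big_seq1.
have runE w : run s0 (history_word (rcons tw (D, w))) = run s w.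
  by rewrite /history_word map_rcons flatten_rcons foldl_cat.
have BFE w : fine (P (B `&` F w)) = q * (poisson_weight C D (size w) * f (run s w)).
  rewrite -(probability_setI1 _ measurable_regular regular1); last exact: measurableI.
  pose G := F w `&` later (history_end tw + D) ev.
  have mG : measurable G by apply: measurableI => //; exact: measurable_later.
  have -> : B `&` F w `&` regular = if E i (run s w) then G `&` regular else set0.
    have UE o : F w o -> regular o -> (U i o < history_end tw + D) = E i (run s w).
      rewrite /F history_rcons add0r => -[_ Fw] reg.
      rewrite (last_change_time_lt (ent i) (regular_listing reg)).
      rewrite (state_before_listing _ _ Fw) -runE; congr (E i _).
      rewrite /history_word map_rcons flatten_rcons.
      rewrite -[in RHS](map_fst_rings_of (fun=> 0%N) (_ ++ _)).
      by elim: (rings_of _ _) s0 => /=.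
    apply/seteqP; split=> o.
      move=> [[[Ho [/= Uo lo]] Fo] reg]; move: (UE _ Fo reg); rewrite Uo => <-.
      by [].
    case: ifP => // Eo [[Fo lo] reg]; split=> //; split=> //; split; first exact: FH Fo.
    by split => //=; rewrite UE.
  rewrite /f; case: (E i (run s w)); last by rewrite measure0/= mul0r !mulr0.
  rewrite (probability_setI1 mG measurable_regular regular1) /G -(endE w) IH// runE.
  by rewrite /history_weight -cats1 big_cat big_seq1/=; rewrite mul1r mulrA.
have cvg1 : (q * flow_sum step D f s l) @[l --> \oo] --> q * flow step D f s.
  by apply: cvgM; [exact: cvg_cst|exact: flow_cvg].
have cvg2 : (q * flow_sum step D f s l + q * (1 - flow_sum step D (fun=> 1) s l))
    @[l --> \oo] --> q * flow step D f s.
  have : (q * flow_sum step D f s l + q * (1 - flow_sum step D (fun=> 1) s l))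
    @[l --> \oo] --> q * flow step D f s + q * (1 - 1).
    apply: cvgD; first exact: cvg1.
    apply: cvgM; first exact: cvg_cst.
    by apply: cvgB; [exact: cvg_cst|exact: flow_sum1_cvg].
  by rewrite subrr mulr0 addr0.
have lb l : q * flow_sum step D f s l <= fine (P B).
  rewrite flow_sum_words mulr_sumr; under eq_bigr do rewrite -BFE.
  apply: (@sum_disjoint_le _ _ _ P _ (words_upto l) (fun w => B `&` F w) B
    (words_upto_uniq l) (fun w => measurableI _ _ mB (mF w)) mB).
  - by move=> w w' _ _ o [_ Fw] [_ Fw']; exact: history_disjoint Fw Fw'.
  - by move=> w _ o [].
(* The upper bound is the disjoint-sum inequality applied to the complement of B in H; the last term
   accounts for the words of length at least l. *)
have ub l : fine (P B) <= q * flow_sum step D f s l + q * (1 - flow_sum step D (fun=> 1) s l).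
  have mH : measurable H by exact: measurable_history.
  have mD : measurable (H `\` B) by exact: measurableD.
  have split_B A : measurable A -> fine (P A) = fine (P (A `\` B)) + fine (P (B `&` A)).
    move=> mA; rewrite (measureDI P (B := B))// fineD ?fin_num_measure//.
    - by rewrite setIC.
    - exact: measurableD.
    - exact: measurableI.
  have HB : fine (P (H `\` B)) = q - fine (P B).
    have := split_B _ mH; rewrite history_eq// -/q.
    rewrite [B `&` H]setIidl; last by move=> o [].
    by move=> ->; rewrite addrK.
  have := @sum_disjoint_le _ _ _ P _ (words_upto l) (fun w => F w `\` B) (H `\` B).
  move=> /(_ (words_upto_uniq l) (fun w => measurableD (mF w) mB) mD).
  rewrite HB => le.
  have : \sum_(w <- words_upto l) fine (P (F w `\` B)) <= q - fine (P B).
    apply: le; first by move=> w w' _ _ o [Fw _] [Fw' _]; exact: history_disjoint Fw Fw'.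
    by move=> w _ o [/FH].
  rewrite (eq_bigr (fun w => q * (poisson_weight C D (size w) * 1) -
      q * (poisson_weight C D (size w) * f (run s w)))); last first.
    by move=> w _; rewrite -BFE mulr1 -FE (split_B _ (mF w)) addrK.
  rewrite sumrB.
  have sumE g : \sum_(w <- words_upto l) q * (poisson_weight C D (size w) * g (run s w)) =
      q * flow_sum step D g s l by rewrite flow_sum_words mulr_sumr.
  by rewrite (sumE (fun=> 1)) (sumE f); lra.
apply/eqP; rewrite eq_le; apply/andP; split.
  apply: (closed_cvg (fun x : R => fine (P B) <= x) _ _ _ cvg2); first exact: closed_ge.
  by apply: nearW => l; exact: ub.
apply: (closed_cvg (fun x : R => x <= fine (P B)) _ _ _ cvg1); first exact: closed_le.
by apply: nearW => l; exact: lb.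
Qed.

Lemma last_change_law ev : {in ev, forall x, 0 <= x.1} ->
  fine (P (later 0 ev)) = value ev s0.
Proof.
move=> ev0; have := @later_value [::] ev (fun _ => ltac:(by [])) ev0.
by rewrite /history_end /history_weight !big_nil /= setTI mul1r.
Qed.

End markov.

(** * Transfer along the kernel *)

Section uniformization.
Context {R : realType} {C : finType} {S : Type}.
Variable step : C -> S -> S.

(** This adds idle clocks of total rate c. *)
Definition shifted_generator c (f : S -> R) s := generator step f s + c * f s.

Lemma iter_shifted_generator c f k s : iter k (shifted_generator c) f s =
  \sum_(j < k.+1) 'C(k, j)%:R * c ^+ (k - j) * iter j (generator step) f s.
Proof.
elim: k s => [|k IH] s; first by rewrite big_ord1 bin0 expr0 !mul1r.
rewrite iterS {1}/shifted_generator {1}/generator.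
under eq_bigr do rewrite IH.
rewrite exchange_big/= IH mulr_sumr.
rewrite [X in _ + X]big_ord_recl [RHS]big_ord_recl /=.
rewrite [LHS]addrCA; congr (_ + _); first by rewrite !bin0 !subn0 exprS; ring.
have -> : \sum_(i < k) c * ('C(k, bump 0 i)%:R * c ^+ (k - bump 0 i) * iter (bump 0 i) (generator step) f s) =
    \sum_(i < k.+1) 'C(k, i.+1)%:R * c ^+ (k - i) * iter i.+1 (generator step) f s.
  rewrite big_ord_recr/= bin_small// !mul0r addr0; apply: eq_bigr => i _.
  rewrite /bump add1n -[(k - i)%N]prednK ?subn_gt0// -subnS exprS.
  by ring.
rewrite -big_split/=; apply: eq_bigr => i _.
rewrite /bump add1n binS natrD subSS -!mulr_sumr -/(generator step _ s) -iterS.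
ring.
Qed.

(** Cauchy product: the triangle of size l lies in the square of size l, which lies in the triangle
    of size 2l. For nonnegative terms the partial sums therefore satisfy z(l) <= x(l) y(l) <=
    z(2l). *)
Lemma nonneg_convolution (x y : nat -> R) (X Y : R) :
  (forall a, 0 <= x a) -> (forall a, 0 <= y a) ->
  series x @ \oo --> X -> series y @ \oo --> Y ->
  series (fun k => \sum_(j < k.+1) x j * y (k - j)%N) @ \oo --> X * Y.
Proof.
move=> x0 y0 cx cy; set z := fun k => _.
have zE l : series z l = \sum_(j < l) x j * series y (l - j)%N.
  rewrite /series/= big_mkord; elim: l => [|l IH]; first by rewrite !big_ord0.
  rewrite big_ord_recr/= IH [RHS]big_ord_recr/= subSnn big_nat1.
  rewrite /z big_ord_recr/= subnn addrA; congr (_ + _).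
  rewrite -big_split/=; apply: eq_bigr => j _.
  by rewrite subSn ?(ltnW (ltn_ord j))// big_nat_recr//= mulrDr.
have ndy : nondecreasing_seq (series y).
  by apply/nondecreasing_seqP => l; rewrite /series/= big_nat_recr//= lerDl.
have sy0 l : 0 <= series y l by rewrite /series/= sumr_ge0.
have cxy : (fun l => series x l * series y l) @ \oo --> X * Y by apply: cvgM.
have zxy l : series z l <= series x l * series y l.
  rewrite zE [series x l]/series/= big_mkord mulr_suml; apply: ler_sum => j _.
  by rewrite ler_wpM2l//; apply: ndy; rewrite leq_subr.
have nd (u : nat -> R) : (forall a, 0 <= u a) -> nondecreasing_seq (series u).
  by move=> u0; apply/nondecreasing_seqP => l; rewrite /series/= big_nat_recr//= lerDl.
have z0 k : 0 <= z k by apply: sumr_ge0 => j _; rewrite mulr_ge0.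
have cz : cvgn (series z).
  apply: nondecreasing_is_cvgn; first exact: nd.
  exists (X * Y) => _ [l _ <-]; apply: le_trans (zxy l) _.
  have lim_le (u : nat -> R) (U : R) : (forall a, 0 <= u a) -> series u @ \oo --> U -> series u l <= U.
    move=> u0 cu; rewrite -(cvg_lim _ cu)//; apply: nondecreasing_cvgn_le; first exact: nd.
    by apply/cvg_ex; exists U.
  by apply: ler_pM; [rewrite /series/= sumr_ge0|exact: sy0|exact: lim_le|exact: lim_le].
suff <- : limn (series z) = X * Y by [].
set Z := limn _ in cz *.
have cz2 : (fun l => series z (l + l)%N) @ \oo --> Z.
  apply: (cvg_comp (fun l : nat => (l + l)%N) (series z)) cz.
  by apply/cvgnyPge => A; exists A => // l /= Al; rewrite (leq_trans Al) ?leq_addr.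
apply/eqP; rewrite eq_le; apply/andP; split.
  apply: (ler_cvg_to cz cxy); apply: nearW => l.
  exact: zxy.
apply: (ler_cvg_to cxy cz2); apply: nearW => l.
rewrite zE [series x l]/series/= big_mkord mulr_suml big_split_ord/=.
rewrite -[leLHS]addr0; apply: lerD.
  apply: ler_sum => j _; rewrite ler_wpM2l//; apply: ndy.
  by rewrite -addnBA ?leq_addr// ltnW.
by apply: sumr_ge0 => j _; rewrite mulr_ge0.
Qed.

(* Both chains are compared at the same total clock rate. *)
Lemma flow_shifted D f s c : 0 <= D -> 0 <= c -> unit_valued f ->
  (fun l => expR (- ((#|C|%:R + c) * D)) *
     \sum_(k < l) D ^+ k / k`!%:R * iter k (shifted_generator c) f s) @ \oo -->
  flow step D f s.
Proof.
move=> D0 c0 f01.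
pose x a := D ^+ a / a`!%:R * iter a (generator step) f s.
pose z k := D ^+ k / k`!%:R * iter k (shifted_generator c) f s.
have iter0 a u : 0 <= iter a (generator step) f u.
  by rewrite generator_words sumr_ge0// => w _; case/andP: (f01 (foldl (fun s c => step c s) u w)).
have x0 a : 0 <= x a by rewrite !mulr_ge0 ?exprn_ge0// invr_ge0.
have y0 a : 0 <= exp_coeff (c * D) a.
  by rewrite /exp_coeff mulr_ge0 ?exprn_ge0 ?mulr_ge0// invr_ge0.
have zE k : z k = \sum_(j < k.+1) x j * exp_coeff (c * D) (k - j)%N.
  rewrite /z iter_shifted_generator mulr_sumr; apply: eq_bigr => -[j /= jk] _.
  rewrite /x /exp_coeff/= exprMn.
  have -> : D ^+ k = D ^+ j * D ^+ (k - j) by rewrite -exprD subnKC// -ltnS.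
  have <- := bin_fact (ltnSE jk).
  by rewrite !natrM; field; rewrite !pnatr_eq0 -!lt0n !fact_gt0 bin_gt0 ltnSE.
have cx : series x @ \oo --> expR (#|C|%:R * D) * flow step D f s.
  have -> : series x = (fun l => expR (#|C|%:R * D) * flow_sum step D f s l).
    apply/funext => l; rewrite /flow_sum mulr_sumr /series/= big_mkord.
    apply: eq_bigr => a _; rewrite /x /poisson_weight expRN; field.
    by rewrite pnatr_eq0 -lt0n fact_gt0 gt_eqF ?expR_gt0.
  by apply: cvgM; [exact: cvg_cst|exact: flow_cvg].
have cy : series (exp_coeff (c * D)) @ \oo --> expR (c * D).
  exact: is_cvg_series_exp_coeff.
have := nonneg_convolution x0 y0 cx cy.
have -> : (fun k => \sum_(j < k.+1) x j * exp_coeff (c * D) (k - j)%N) = z.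
  by apply/funext => k; rewrite zE.
move=> cz.
have : (fun l => expR (- ((#|C|%:R + c) * D)) * series z l) @ \oo -->
    expR (- ((#|C|%:R + c) * D)) * (expR (#|C|%:R * D) * flow step D f s * expR (c * D)).
  by apply: cvgM cz; exact: cvg_cst.
have -> : expR (- ((#|C|%:R + c) * D)) * (expR (#|C|%:R * D) * flow step D f s * expR (c * D)) =
    flow step D f s.
  by rewrite mulrDl opprD expRD !expRN; field; rewrite !gt_eqF ?expR_gt0.
by rewrite /series/=; under eq_fun do rewrite big_mkord.
Qed.

End uniformization.

Section bisimulation.
Context {R : realType} {C : finType} {S S' : Type}.
Variables (step : C -> S -> S) (step' : C -> S' -> S') (sim : S -> S' -> Prop).
Hypothesis sim_step : forall c s s', sim s s' -> sim (step c s) (step' c s').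

Lemma flow_sim D (f : S -> R) f' s s' :
  (forall u u', sim u u' -> f u = f' u') -> sim s s' ->
  flow step D f s = flow step' D f' s'.
Proof.
move=> ff' ss'; rewrite /flow; congr (limn _); apply/funext => l.
rewrite !flow_sum_words; apply: eq_bigr => w _; congr (_ * _); apply: ff'.
by elim: w s s' ss' => //= c w IH s s' /(sim_step c); exact: IH.
Qed.

End bisimulation.

(** This replaces permutations and sets of boxes by the label lists and row lengths on which the
    check computes. *)
Lemma value_sim (R : realType) (C : finType) (S S' : eqType)
    (step : C -> S -> S) (step' : C -> S' -> S') (sim : S -> S' -> Prop)
    m (E : 'I_m -> pred S) (E' : 'I_m -> pred S') (ev : seq (R * 'I_m)) s s' :
  (forall c s s', sim s s' -> sim (step c s) (step' c s')) ->
  (forall i s s', sim s s' -> E i s = E' i s') -> sim s s' ->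
  value step E ev s = value step' E' ev s'.
Proof.
move=> simS simE; elim: ev s s' => [//|[D i] ev IH] s s' ss' /=.
by apply: flow_sim ss' => // u u' uu'; rewrite (simE _ _ _ uu') (IH _ _ uu').
Qed.

Section transport.
Context {R : realType} (n : nat) (Y : seq (seq nat)) (K : seq nat -> vec n).
Hypothesis checkK : kernel_check Y K.

Local Notation twined := (@intertwined R n Y K).

Definition box_pair (b : staircase_box n) : nat * nat :=
  (nat_of_ord (val b).1, nat_of_ord (val b).2).

Definition swap_labels (i : 'I_n.-1) := pstep i.

Definition grow_rows (b : staircase_box n) := grow (box_pair b).

Lemma perm_boxes : perm_eq (map box_pair (index_enum (staircase_box n))) (boxes n).
Proof.
apply: uniq_perm.
- rewrite map_inj_uniq ?index_enum_uniq// => -[[i j] ij] [[i' j'] ij'] [/val_inj ii /val_inj jj].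
  by apply: val_inj; rewrite /= ii jj.
- apply: allpairs_uniq_dep; rewrite ?iota_uniq//.
    by move=> i _; exact: iota_uniq.
  by move=> [i j] [i' j'] _ _ [-> ->].
move=> [i j]; apply/mapP/allpairsPdep => [[b _ [-> ->]]|[i' [j' [+ + [-> ->]]]]].
  exists (nat_of_ord (val b).1), (nat_of_ord (val b).2).
  by rewrite !mem_iota/= !add0n ltn_ord ltn_subRL (valP b).
rewrite !mem_iota/= !add0n ltn_subRL => i'n ij.
have j'n : (j' < n.-1)%N by apply: leq_ltn_trans ij; rewrite leq_addl.
exists (exist _ (Ordinal i'n, Ordinal j'n) ij : staircase_box n) => //.
by rewrite mem_index_enum.
Qed.

Lemma sum_boxes (h : nat * nat -> R) :
  \sum_(b : staircase_box n) h (box_pair b) = \sum_(x <- boxes n) h x.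
Proof. by rewrite -(big_map box_pair predT h); apply/perm_big/perm_boxes. Qed.

Lemma card_staircase_box : #|staircase_box n| = size (boxes n).
Proof.
by rewrite cardT enumT -(size_map box_pair); apply/perm_size/perm_boxes.
Qed.

Lemma ev_fun_scale p (v : vec p) c (F : seq nat -> R) :
  ev v (fun l => c * F l) = c * ev v F.
Proof.
elim: p v F => [|p IH] v F /=; first by ring.
by rewrite mulr_sumr; apply: eq_bigr => j _; rewrite IH.
Qed.

Lemma intertwined_lin c F F' G G' : twined F G -> twined F' G' ->
  twined (fun l => F l + c * F' l) (fun la => G la + c * G' la).
Proof.
move=> FG FG' la laY; rewrite FG// FG'//.
elim: (n) (K la) F F' {FG FG'} => [|p IH] v F F' /=; first by ring.
by rewrite mulr_sumr -big_split; apply: eq_bigr => j _; exact: IH.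
Qed.

Lemma intertwined_ext F F' G G' : F =1 F' -> G =1 G' ->
  twined F G -> twined F' G'.
Proof. by move=> /funext <- /funext <-. Qed.

(** Each side receives as many idle clocks as the other has clocks, so both operators are the
    generator plus the same multiple of the identity. *)
Lemma intertwined_shifted F G : twined F G ->
  twined (shifted_generator swap_labels #|staircase_box n|%:R F)
    (shifted_generator grow_rows #|'I_n.-1|%:R G).
Proof.
move=> FG; have FG' := intertwined_generator checkK FG.
apply: intertwined_ext (intertwined_lin (#|staircase_box n|%:R + #|'I_n.-1|%:R) FG' FG).
  move=> l; rewrite /shifted_generator /generator sumrB sumr_const.
  by rewrite -mulr_natl; ring.
move=> la; rewrite /shifted_generator /generator (sum_boxes (fun x => G (grow x la))).
rewrite sumrB [X in _ - X](_ : _ = #|staircase_box n|%:R * G la); first by ring.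
by rewrite big_const_seq count_predT iter_addr addr0 card_staircase_box mulr_natl.
Qed.

Lemma ev_cvg p (v : vec p) (F : nat -> seq nat -> R) (F' : seq nat -> R) :
  (forall l, F ^~ l @ \oo --> F' l) -> (fun k => ev v (F k)) @ \oo --> ev v F'.
Proof.
elim: p v F F' => [|p IH] v F F' cF /=.
  by apply: cvgM; [exact: cvg_cst|exact: cF].
elim: (index_enum _) => [|j s IHs].
  by under eq_fun do rewrite big_nil; rewrite big_nil; exact: cvg_cst.
under eq_fun do rewrite big_cons; rewrite big_cons.
by apply: cvgD IHs; apply: IH => l; exact: cF.
Qed.

(** The truncated series are intertwined term by term, and [ev], a finite sum, commutes with the
    limit. *)
Lemma intertwined_flow D F G : 0 <= D -> unit_valued F -> unit_valued G ->
  twined F G ->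
  twined (flow swap_labels D F) (flow grow_rows D G).
Proof.
move=> D0 F01 G01 FG.
set c1 : R := #|staircase_box n|%:R; set c2 : R := #|'I_n.-1|%:R.
pose F_ k l := expR (- ((c2 + c1) * D)) * \sum_(a < k) D ^+ a / a`!%:R *
  iter a (shifted_generator swap_labels c1) F l.
pose G_ k la := expR (- ((c1 + c2) * D)) * \sum_(a < k) D ^+ a / a`!%:R *
  iter a (shifted_generator grow_rows c2) G la.
have FG_ k : twined (F_ k) (G_ k).
  have FGa a : twined (iter a (shifted_generator swap_labels c1) F)
      (iter a (shifted_generator grow_rows c2) G).
    by elim: a => // a; exact: intertwined_shifted.
  have FG0 : twined (fun l => \sum_(a < k) D ^+ a / a`!%:R *
        iter a (shifted_generator swap_labels c1) F l)
      (fun la => \sum_(a < k) D ^+ a / a`!%:R *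
        iter a (shifted_generator grow_rows c2) G la).
    move=> la laY; rewrite ev_fun_sum; apply: eq_bigr => a _.
    by rewrite ev_fun_scale FGa.
  by move=> la laY; rewrite /F_ ev_fun_scale /G_ FG0// addrC.
move=> la laY.
have cG : G_ ^~ la @ \oo --> flow grow_rows D G la by exact: flow_shifted.
have cF : (fun k => ev (K la) (F_ k)) @ \oo --> ev (K la) (flow swap_labels D F).
  by apply: ev_cvg => l; exact: flow_shifted.
have E : G_ ^~ la = (fun k => ev (K la) (F_ k)) by apply/funext => k; exact: FG_.
by rewrite E in cG; exact: cvg_unique cG cF.
Qed.

Hypothesis n_gt0 : (0 < n)%N.

Lemma value_transport (ev : seq (R * 'I_n.-1)) : {in ev, forall x, 0 <= x.1} ->
  value swap_labels (fun k => top_block n k : pred (seq nat)) ev (iota 0 n) =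
  value grow_rows (fun k la => (k < nth 0 la (n.-2 - k))%N) ev (nseq n.-1 0%N).
Proof.
move=> ev0; apply/esym.
suff : twined (value swap_labels (fun k => top_block n k : pred (seq nat)) ev)
  (value grow_rows (fun k la => (k < nth 0 la (n.-2 - k))%N) ev).
  exact: (intertwined0 checkK).
elim: ev ev0 => [_|[D k] ev IH ev0] /=; first by have := intertwined1 R checkK.
have D0 : 0 <= D by apply: (ev0 (D, k)); rewrite mem_head.
have {}ev0 : {in ev, forall x, 0 <= x.1}.
  by move=> x xe; apply: ev0; rewrite inE xe orbT.
apply: intertwined_flow => //; try by apply/indicator_unit_valued/value_unit_valued.
by apply: (intertwined_block checkK); [exact: IH|exact: ltn_ord].
Qed.

End transport.

(** * Measurability of last change times *)

Section measurable_last_change.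
Context {R : realType} d (T : measurableType d) (P : probability T R).
Context (C : finType) (gap : C -> nat -> {RV P >-> R}).
Context (S : eqType) (step : C -> S -> S) (s0 : S).

Local Notation ring := (ring_rv gap).
Local Notation gaps_of := (gaps_of gap).

Lemma measurable_countable (I : countType) (A : I -> set T) (p : pred I) :
  (forall i, p i -> measurable (A i)) ->
  measurable [set w | exists2 i, p i & A i w].
Proof.
move=> mA; have -> : [set w | exists2 i, p i & A i w] = \bigcup_j
    (if (choice.unpickle j : option I) is Some i then if p i then A i else set0 else set0).
  apply/seteqP; split => w.
    by move=> [i pi Ai]; exists (choice.pickle i) => //; rewrite choice.pickleK pi.
  move=> [j _]; case: (choice.unpickle j : option I) => [i|//].
  by case: ifP => // pi Ai; exists i.
apply: bigcupT_measurable => j; case: (choice.unpickle j : option I) => [i|//].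
by case: ifP => // pi; exact: mA.
Qed.

(** The result of sorting, ties included, depends only on the table of comparisons, which takes
    finitely many values. *)
Lemma measurable_sort (s l : seq (C * nat)) :
  measurable [set w | sort (fun e f => ring e w <= ring f w) s = l].
Proof.
case: s => [|e0 s'].
  have [<-|l0] := eqVneq [::] l.
    by have -> : [set w : T | [::] = [::] :> seq (C * nat)] = setT by apply/seteqP.
  rewrite (_ : [set w | _] = set0)//.
  by apply/seteqP; split=> w //= e; rewrite -e eqxx in l0.
set s := e0 :: s'; pose n := size s; pose nths (i : 'I_n) := nth e0 s i.
pose B w : {ffun 'I_n * 'I_n -> bool} :=
  [ffun x => ring (nths x.1) w <= ring (nths x.2) w].
pose F (phi : {ffun 'I_n * 'I_n -> bool}) :=
  map nths (sort (fun i j => phi (i, j)) (enum 'I_n)).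
have sortE w : sort (fun e f => ring e w <= ring f w) s = F (B w).
  have -> : s = map nths (enum 'I_n).
    by rewrite map_comp val_enum_ord -/(mkseq _ _) mkseq_nth.
  rewrite sort_map /F; congr (map _ (sort _ _)).
  by apply/funext => i; apply/funext => j; rewrite ffunE.
have -> : [set w | sort (fun e f => ring e w <= ring f w) s = l] =
    [set w | exists2 phi, F phi == l & [set w | B w = phi] w].
  apply/seteqP; split => w /=; rewrite sortE.
    by move=> <-; exists (B w).
  by move=> [phi /eqP <- ->].
apply: measurable_countable => phi _.
have -> : [set w | B w = phi] =
    \bigcap_(x in [set: 'I_n * 'I_n]) [set w | phi x = (ring (nths x.1) w <= ring (nths x.2) w)].
  apply/seteqP; split => w /=; first by move=> <- x _; rewrite /= ffunE.
  by move=> H; apply/ffunP => x; rewrite ffunE H.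
apply: fin_bigcap_measurable => // x _; apply: measurable_eq_bool erefl _.
have -> : [set w | ring (nths x.1) w <= ring (nths x.2) w] =
    ~` [set w | ring (nths x.2) w < ring (nths x.1) w].
  by apply/seteqP; split => w /=; rewrite leNgt => /negP.
exact/measurableC/measurable_ring_ltr.
Qed.

(** Measurability concerns all samples, also those with infinitely many rings before a time, where
    [fset_set] returns the empty set. The preimage of [fset0] is therefore obtained as the
    complement of the countably many others. *)
Lemma measurable_fset_set e (F : {fset C * nat}) :
  measurable [set w | fset_set [set f | ring f w < ring e w] = F].
Proof.
have mF G : G != fset0 ->
    measurable [set w | fset_set [set f | ring f w < ring e w] = G].
  move=> G0.
  have -> : [set w | fset_set [set f | ring f w < ring e w] = G] =
    ~` [set w | exists2 f, true & [set w | (f \in G) != (ring f w < ring e w)] w].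
    apply/seteqP; split => w /=.
      move=> GE [f _ /eqP]; apply; rewrite -GE in_fset_set ?inE//.
        by apply/idP/idP; rewrite inE.
      by apply: contrapT => inf; move: G0; rewrite -GE /fset_set; case: pselect.
    move=> H; have -> : [set f | ring f w < ring e w] = [set` G].
      apply/seteqP; split => f /=; have /negPn/eqP -> // : ~~ ((f \in G) != (ring f w < ring e w)).
        by apply/negP => fH; apply: H; exists f.
      by apply/negP => fH; apply: H; exists f.
    exact: set_fsetK.
  apply: measurableC; apply: measurable_countable => f _.
  have -> : [set w | (f \in G) != (ring f w < ring e w)] =
      ~` [set w | (f \in G) = (ring f w < ring e w)].
    by apply/seteqP; split => w /= /eqP.
  exact/measurableC/measurable_eq_bool/measurable_ring_ltr.
have [->|] := eqVneq F fset0; last exact: mF.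
have -> : [set w | fset_set [set f | ring f w < ring e w] = fset0] =
    ~` [set w | exists2 G, G != fset0 &
      [set w | fset_set [set f | ring f w < ring e w] = G] w].
  apply/seteqP; split => w /=; first by move=> -> [G /eqP ? /esym].
  by move=> H; apply/eqP/negPn/negP => G0; apply: H; eexists; first exact: G0.
by apply: measurableC; apply: measurable_countable => G; exact: mF.
Qed.

Lemma measurable_state_pred e (p : pred S) :
  measurable [set w | p (state_before step s0 (gaps_of w) (ring e w))].
Proof.
pose q (x : {fset C * nat} * seq (C * nat)) := p (foldl (fun s e => step e.1 s) s0 x.2).
have -> : [set w | p (state_before step s0 (gaps_of w) (ring e w))] =
  [set w | exists2 x, q x & ([set w | fset_set [set f | ring f w < ring e w] = x.1] `&`
     [set w | sort (fun e f => ring e w <= ring f w) x.1 = x.2]) w].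
  apply/seteqP; split => w /=.
    move=> pw; exists (fset_set [set f | ring f w < ring e w],
      sort (fun e f => ring e w <= ring f w) (fset_set [set f | ring f w < ring e w])) => //.
  move=> [[F l] /= ql [FE lE]]; rewrite /q/= in ql.
  by rewrite /state_before -[X in sort X]/(fun e f => ring e w <= ring f w) FE lE.
apply: measurable_countable => x _; apply: measurableI.
  exact: measurable_fset_set.
exact: measurable_sort.
Qed.

Lemma measurable_last_change_time k :
  measurable_fun setT (fun w => last_change_time step s0 (gaps_of w) k).
Proof.
pose ch m w := let s := state_before step s0 (gaps_of w) (ring (k, m) w) in step k s != s.
pose h m w : \bar R := if ch m w then (ring (k, m) w)%:E else -oo%E.
have mh m : measurable_fun setT (h m).
  apply: measurable_fun_ifT => //.
    apply: (measurable_fun_bool true).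
    rewrite setTI (_ : _ @^-1` _ = [set w | ch m w]); last by apply/seteqP; split.
    exact: (measurable_state_pred (k, m) (fun s => step k s != s)).
  by apply/measurable_EFinP; exact: measurable_ring.
have -> : (fun w => last_change_time step s0 (gaps_of w) k) =
    (fun w => fine (esups (h ^~ w) 0)).
  apply/funext => w; set A := change_times step s0 (gaps_of w) k.
  have -> : esups (h ^~ w) 0 = ereal_sup (EFin @` A).
    apply/eqP; rewrite eq_le; apply/andP; split.
      apply: ge_ereal_sup => _ [m _ <-]; rewrite /h; case: ifP => [chm|_]; last exact: leNye.
      by apply: ereal_sup_ubound; exists (ring (k, m) w) => //; exists m.
    apply: ge_ereal_sup => _ [_ [m chm <-] <-]; apply: ereal_sup_ubound; exists m => //.
    by rewrite /h ifT.
  (* For A empty or unbounded, [sup] is 0 by convention, and so is [fine] of the infinite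
     supremum. *)
  rewrite /last_change_time -/A.
  have [->|/set0P A0] := eqVneq A set0; first by rewrite image_set0 ereal_sup0 sup0.
  have [ubA|nubA] := pselect (has_ubound A); first by rewrite ereal_sup_EFin.
  by rewrite hasNub_ereal_sup// sup_out// => -[].
apply: measurableT_comp; first exact: fine_measurable.
exact: measurable_fun_esups.
Qed.

End measurable_last_change.

(** * The two chains *)

Section swap_chain.
Variable n : nat.

Local Notation step := (@swap_step n).
Local Notation run := (foldl (fun s c => step c s)).

Definition labels (s : 'S_n) : seq nat := [seq (s p : nat) | p <- enum 'I_n].

Definition swap_block (i : 'I_n.-1) (s : 'S_n) := top_block n i (labels s).

Lemma size_labels s : size (labels s) = n.
Proof. by rewrite size_map size_enum_ord. Qed.

Lemma nth_labels (s : 'S_n) (p : 'I_n) : nth 0%N (labels s) p = s p.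
Proof. by rewrite (nth_map p) ?size_enum_ord// nth_ord_enum. Qed.

Lemma labels1 : labels 1%g = iota 0 n.
Proof. by rewrite -val_enum_ord; apply: eq_map => p; rewrite perm1. Qed.

Lemma labels_uniq s : uniq (labels s).
Proof. by rewrite map_inj_uniq ?enum_uniq// => p q /val_inj/perm_inj. Qed.

Lemma mem_labels s x : (x \in labels s) = (x < n)%N.
Proof.
apply/mapP/idP => [[p _ ->]|xn]; first exact: ltn_ord.
exists ((s^-1)%g (Ordinal xn)); first by rewrite mem_enum.
by rewrite permKV.
Qed.

Lemma nth_pstep i l j : (i.+1 < size l)%N -> nth 0%N (pstep i l) j =
  if (nth 0%N l i < nth 0%N l i.+1)%N then
    if j == i then nth 0%N l i.+1 else if j == i.+1 then nth 0%N l i else nth 0%N l j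
  else nth 0%N l j.
Proof.
elim: i l j => [|i IH] [|a l] j //=.
  by case: l => [|b l] //= _; case: ifP => //; case: j => [|[|j]].
by move=> il; case: j => [|j] /=; [case: ifP|rewrite IH].
Qed.

Lemma labels_step i s : labels (step i s) = pstep i (labels s).
Proof.
have i1 : (i.+1 < n)%N by rewrite -ltn_predRL.
apply: (@eq_from_nth _ 0%N); first by rewrite pstep_size !size_labels.
move=> j; rewrite size_labels => jn.
have Li : nth 0%N (labels s) i = s (left_pos i) := nth_labels s (left_pos i).
have Ri : nth 0%N (labels s) i.+1 = s (right_pos i) := nth_labels s (right_pos i).
have -> : nth 0%N (labels (step i s)) j = step i s (Ordinal jn) := nth_labels _ (Ordinal jn).
have Lj : nth 0%N (labels s) j = s (Ordinal jn) := nth_labels s (Ordinal jn).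
rewrite nth_pstep ?size_labels// Li Ri Lj /swap_step; case: ifP => // _.
rewrite permM; case: tpermP => [/(congr1 val)/= ji|/(congr1 val)/= ji|/eqP jl /eqP jr].
- by rewrite ifT//; apply/eqP.
- by rewrite ifF ?ifT//; apply/eqP; rewrite ji//; lia.
by rewrite -!val_eqE /= in jl jr; rewrite /= (negPf jl) (negPf jr).
Qed.

(** A rank for sorting: earlier positions weigh more, so moving the larger label to the left
    increases it. *)
Fixpoint weighted_sum (l : seq nat) : nat :=
  if l is a :: l' then (a * size l + weighted_sum l')%N else 0%N.

Lemma weighted_sum_pstep i l : pstep i l != l ->
  (weighted_sum l < weighted_sum (pstep i l))%N.
Proof.
elim: i l => [|i IH] [|a l] //=; rewrite ?eqxx//.
  case: l => [|b l]; rewrite ?eqxx//=; case: ifP; rewrite ?eqxx// => ab _.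
  by rewrite [weighted_sum [:: b, a & l]]/= !mulnS; lia.
by rewrite eqseq_cons eqxx /= => /IH; rewrite pstep_size ltn_add2l.
Qed.

(** A swap at i stays on one side of the boundary between positions j and [j.+1]. *)
Lemma take_pstep_perm i j l : i != j ->
  perm_eq (take j.+1 (pstep i l)) (take j.+1 l).
Proof.
elim: i j l => [|i IH] j [|a l] //=.
  case: j => [//|j] _; case: l => [|b l]//; case: ifP => // _ /=.
  by rewrite -(cat1s b) -(cat1s a) perm_catCA.
case: j => [|j] ij; first by rewrite !take0.
by rewrite perm_cons; apply: IH.
Qed.

Lemma swap_block_step i c s : c != i -> swap_block i (step c s) = swap_block i s.
Proof.
move=> ci; rewrite /swap_block labels_step; apply/perm_all/take_pstep_perm.
by rewrite val_eqE.
Qed.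

(* The i + 1 first labels are the i + 1 largest ones, so the next one is
   smaller than all of them. *)
Lemma swap_block_fixed i s : swap_block i s -> step i s = s.
Proof.
have i1 : (i.+1 < n)%N by rewrite -ltn_predRL.
move=> Es; rewrite /swap_step ifF//; apply/negbTE; rewrite -leqNgt -!nth_labels /=.
have top j : (j <= i)%N -> (n - i.+1 <= nth 0 (labels s) j)%N.
  rewrite -ltnS => ji; have /(all_nthP 0%N)/(_ j) := Es.
  by rewrite size_takel ?size_labels ?(ltnW i1)// nth_take// => /(_ ji).
have topi := top i (leqnn i).
apply: leq_trans topi; rewrite leqNgt; apply/negP => next.
have : {subset take i.+2 (labels s) <= iota (n - i.+1) i.+1}.
  move=> x /(nthP 0%N)[j]; rewrite size_take_min size_labels (minn_idPl i1) => ji <-.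
  rewrite nth_take// mem_iota subnK; last exact: ltnW.
  have jn : (j < n)%N by exact: leq_trans i1.
  rewrite -[X in nth _ _ X]/(nat_of_ord (Ordinal jn)) nth_labels ltn_ord andbT -nth_labels/=.
  by move: ji; rewrite ltnS leq_eqVlt => /predU1P[->|ji]; [exact: ltnW|exact: top].
move=> /(uniq_leq_size (take_uniq _ (labels_uniq s))).
by rewrite size_iota size_take_min size_labels (minn_idPl i1) ltnn.
Qed.

Lemma swap_final s : (forall c, step c s = s) -> labels s = rev (iota 0 n).
Proof.
move=> fixed; apply: (irr_sorted_eq (leT := gtn)).
- by move=> a b c ab bc; exact: ltn_trans bc ab.
- by move=> a; rewrite /= ltnn.
- apply/(sortedP 0%N) => i; rewrite size_labels => i1.
  have ip : (i < n.-1)%N by rewrite ltn_predRL.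
  have := congr1 labels (fixed (Ordinal ip)); rewrite labels_step => /(congr1 (nth 0%N ^~ i)).
  rewrite nth_pstep ?size_labels// eqxx; case: ifP => [lt e|/negbT].
    by rewrite e ltnn in lt.
  rewrite -leqNgt leq_eqVlt => /predU1P[e|//].
  move/eqP: e; rewrite /= nth_uniq ?size_labels ?labels_uniq// ?(ltnW i1)//.
  by rewrite gtn_eqF.
- by rewrite rev_sorted; exact: iota_ltn_sorted.
- by move=> x; rewrite mem_labels mem_rev mem_iota.
Qed.

Lemma swap_entered i : entered_by step 1%g i (swap_block i)
  (weighted_sum \o labels) (\max_(s : 'S_n) weighted_sum (labels s)).
Proof.
have i1 : (i.+1 < n)%N by rewrite -ltn_predRL.
split.
- rewrite /swap_block labels1; apply/negP => /(all_nthP 0%N)/(_ 0%N).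
  rewrite size_takel ?size_iota ?(ltnW i1)// nth_take// nth_iota ?(leq_trans _ i1)//.
  by move=> /(_ isT); rewrite leqn0 subn_eq0 leqNgt i1.
- move=> c s Es; have [->|ci] := eqVneq c i; first by rewrite swap_block_fixed.
  by rewrite swap_block_step.
- exact: swap_block_fixed.
- by move=> c s ci; rewrite swap_block_step.
- move=> c s cs; rewrite /= labels_step; apply: weighted_sum_pstep.
  rewrite -labels_step; apply: contra cs => /eqP e; apply/eqP/permP => p.
  by apply: val_inj; rewrite /= -!nth_labels e.
- by move=> s; exact: (leq_bigmax (F := fun s => weighted_sum (labels s))).
- move=> w fixed; rewrite /swap_block (swap_final fixed) /top_block.
  apply/allP => x /(nthP 0%N)[j]; rewrite size_take_min size_rev size_iota (minn_idPl (ltnW i1)) => ji <-.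
  rewrite nth_take// nth_rev ?size_iota ?nth_iota.
  + by rewrite add0n leq_sub2l.
  + by rewrite ltn_subrL (leq_trans _ i1).
  + by rewrite (leq_trans ji)// ltnW.
Qed.

End swap_chain.

Section growth_chain.
Variable n : nat.

Local Notation step := (@growth_step n).
Local Notation run := (foldl (fun s c => step c s)).
Local Notation box := (staircase_box n).

Lemma box_eq (b b' : box) : (b == b') =
  ((val b).1 == (val b').1 :> nat) && ((val b).2 == (val b').2 :> nat).
Proof. by rewrite -val_eqE. Qed.

Lemma young_add (la : {set box}) b : is_young_diagram la -> b \notin la ->
  is_young_diagram (b |: la) =
  [forall b' : box, [&& (val b').1 <= (val b).1, (val b').2 <= (val b).2 & b' != b]%N ==> (b' \in la)].
Proof.
move=> yla bla; apply/forall_inP/forallP => [H b'|H c].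
  apply/implyP => /and3P[le1 le2 b'b].
  have := H b; rewrite setU11 => /(_ isT)/forallP/(_ b').
  by rewrite le1 le2 /= in_setU1 (negPf b'b).
rewrite in_setU1 => /predU1P[->|cla]; apply/forallP => b'; apply/implyP => /andP[le1 le2].
  have := H b'; rewrite le1 le2 in_setU1; case: eqVneq => //=.
rewrite in_setU1; move: yla => /forall_inP/(_ _ cla)/forallP/(_ b').
by rewrite le1 le2 => /= ->; rewrite orbT.
Qed.

Lemma young_run w : is_young_diagram (run finset.set0 w).
Proof.
have y0 : is_young_diagram (finset.set0 : {set box}) by apply/forall_inP => b; rewrite inE.
elim: w finset.set0 y0 => //= b w IH la yla; apply: IH.
by rewrite /growth_step; case: ifP => // /andP[].
Qed.

(** A missing box with minimal row plus column could be added, since all boxes weakly above and to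
    the left of it are present. *)
Lemma growth_final (la : {set box}) : is_young_diagram la ->
  (forall b, step b la = la) -> forall b, b \in la.
Proof.
move=> yla fixed b; apply: contraT => bla.
pose size_of (c : box) := ((val c).1 + (val c).2)%N.
case: (@arg_minnP _ b (fun c => c \notin la) size_of bla) => c cla cmin.
have := fixed c; rewrite /growth_step cla young_add//= ifT.
  by move=> e; rewrite -e setU11 in cla.
apply/forallP => b'; apply/implyP => /and3P[le1 le2 b'c]; apply: contraT => /cmin.
by move=> le3; move: b'c le3 le1 le2; rewrite box_eq /size_of /=; lia.
Qed.

Lemma growth_entered i : entered_by step finset.set0 (corner i)
  (fun la : {set box} => corner i \in la) (fun la => #|la|) #|box|.
Proof.
split.
- by rewrite inE.
- by move=> b la ila; rewrite /growth_step; case: ifP => // _; rewrite setU1r.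
- by move=> la ila; rewrite /growth_step ila.
- move=> b la bi; rewrite /growth_step; case: ifP => // _.
  by rewrite in_setU1 eq_sym (negPf bi).
- move=> b la; rewrite /growth_step; case: ifP; last by rewrite eqxx.
  by move=> /andP[bla _] _; rewrite cardsU1 bla.
- by move=> la; exact: max_card.
- by move=> w fixed; apply: growth_final fixed _; exact: young_run.
Qed.

Definition rows_of (la : {set box}) (r : seq nat) := is_young_diagram la /\
  forall b : box, (b \in la) = ((val b).2 < nth 0 r (val b).1)%N.

Lemma box_at i j : (i + j < n.-1)%N -> exists b : box, (val b).1 = i :> nat /\ (val b).2 = j :> nat.
Proof.
move=> ij; have i1 : (i < n.-1)%N by apply: leq_ltn_trans ij; rewrite leq_addr.
have j1 : (j < n.-1)%N by apply: leq_ltn_trans ij; rewrite leq_addl.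
by exists (exist _ (Ordinal i1, Ordinal j1) ij : box).
Qed.

(** A box is addable iff its left and upper neighbours, where they exist, are present and it is not:
    the boxes further up and to the left follow from the Young property. *)
Lemma rows_of_addable b (la : {set box}) r : rows_of la r ->
  (b \notin la) && is_young_diagram (b |: la) =
  (nth 0%N r (val b).1 == (val b).2 :> nat) &&
    (((val b).1 == 0%N :> nat) || ((val b).2 < nth 0%N r (val b).1.-1)%N).
Proof.
move=> [yla lar]; have bn := valP b.
have [bla|bla] := boolP (b \in la).
  by apply/esym/negbTE; rewrite lar in bla; rewrite gtn_eqF.
have rb : (nth 0%N r (val b).1 <= (val b).2)%N by rewrite leqNgt -lar.
rewrite young_add//=; apply/forallP/andP => [H|[/eqP rE up] c].
  split.
    rewrite eqn_leq rb leqNgt /=; apply/negP => lt.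
    have [|c [c1 c2]] := @box_at (val b).1 (val b).2.-1; first by move: bn lt => /=; lia.
    have := H c; rewrite box_eq c1 c2 leqnn leq_pred lar c1 c2 /=.
    by move: lt => /=; lia.
  have [//|i0] := eqVneq ((val b).1 : nat) 0%N.
  have [|c [c1 c2]] := @box_at (val b).1.-1 (val b).2; first by move: bn i0 => /=; lia.
  have := H c; rewrite box_eq c1 c2 leqnn leq_pred lar c1 c2 /=.
  by move: i0 => /=; lia.
apply/implyP => /and3P[le1 le2 cb].
have [e1|e1] := eqVneq ((val c).1 : nat) (val b).1.
  by rewrite lar e1 rE; move: cb le2; rewrite box_eq e1 eqxx /=; lia.
have i0 : ((val b).1 : nat) != 0%N by move: e1 le1 => /=; lia.
rewrite (negPf i0) /= in up.
have [|c' [c1 c2]] := @box_at (val b).1.-1 (val b).2; first by move: bn i0 => /=; lia.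
have c'la : c' \in la by rewrite lar c1 c2.
move: yla => /forall_inP/(_ _ c'la)/forallP/(_ c)/implyP; apply.
by rewrite c1 c2 le2 andbT; move: e1 le1 => /=; lia.
Qed.

Lemma rows_of_step b la r : rows_of la r -> rows_of (step b la) (grow_rows b r).
Proof.
move=> lar; rewrite /growth_step /grow_rows /grow /box_pair /= -(rows_of_addable b lar).
case: ifP => // add; have [yla mla] := lar; have /andP[bla yb] := add.
split=> // c; rewrite in_setU1 mla nth_set_nth /= box_eq.
move: add; rewrite (rows_of_addable b lar) => /andP[/eqP rE _].
by case: (eqVneq ((val c).1 : nat) (val b).1) => [->|] //=; rewrite rE ltnS [RHS]leq_eqVlt.
Qed.

Lemma rows_of0 : rows_of finset.set0 (nseq n.-1 0%N).
Proof.
split; first by apply/forall_inP => b; rewrite inE.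
by move=> b; rewrite inE nth_nseq; case: ifP.
Qed.

Lemma rows_of_corner i la r : rows_of la r ->
  (corner i \in la) = (i < nth 0%N r (n.-2 - i))%N.
Proof. by move=> [_ ->] /=; congr (_ < nth _ _ _)%N; lia. Qed.

End growth_chain.

(** One evaluation for each n, with exact integer coefficients. *)
Lemma swap_growth_checked n : (2 <= n <= 6)%N -> swap_growth_check n.
Proof.
move: n => [|[|n]] //; move: n => [|[|[|[|[|n]]]]] hn; last by [].
all: vm_compute; reflexivity.
Qed.

Lemma swap_growth_value (R : realType) n (ev : seq (R * 'I_n.-1)) :
  (2 <= n <= 6)%N -> {in ev, forall x, 0 <= x.1} ->
  value (@swap_step n) (@swap_block n) ev 1%g =
  value (@growth_step n) (fun i (la : {set staircase_box n}) => corner i \in la) ev finset.set0.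
Proof.
move=> hn ev0.
rewrite (@value_sim _ _ _ _ _ (@swap_labels n) (fun s l => labels s = l) _ _
  (fun k : 'I_n.-1 => top_block n k) _ _ (iota 0 n)); last 3 first.
- by move=> c s _ <-; exact: labels_step.
- by move=> i s _ <-.
- exact: labels1.
rewrite (value_transport (swap_growth_checked hn) ev0).
apply/esym; apply: (value_sim (sim := @rows_of n)).
- by move=> b la r; exact: rows_of_step.
- by move=> i la r; exact: rows_of_corner.
- exact: rows_of0.
Qed.

Lemma flow0 (R : realType) (C : finType) (S : Type) (step : C -> S -> S) (f : S -> R) s :
  flow step 0 f s = f s.
Proof.
rewrite /flow; apply: cvg_lim => //; apply: cvg_near_cst.
exists 1%N => // l /= l1; rewrite /flow_sum -(prednK l1) big_ord_recl /= big1.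
  by rewrite addr0 /poisson_weight mulr0 oppr0 expR0 expr0 fact0 divr1 !mul1r.
by move=> i _; rewrite /poisson_weight expr0n /= mulr0 !mul0r.
Qed.

(** * Joint distribution functions *)

Section sorted_times.
Context {R : realType} {m : nat}.

Fixpoint increments (t0 : R) (t : 'I_m -> R) (ks : seq 'I_m) : seq (R * 'I_m) :=
  if ks is k :: ks' then (t k - t0, k) :: increments (t k) t ks' else [::].

Lemma increments_ge0 t0 t ks : path (fun x y => x <= y) t0 (map t ks) ->
  {in increments t0 t ks, forall x, 0 <= x.1}.
Proof.
elim: ks t0 => [//|k ks IH] t0 /= /andP[tk /IH {}IH] x; rewrite inE => /predU1P[->|].
  by rewrite subr_ge0.
exact: IH.
Qed.

End sorted_times.

Section boxes.
Context {R : realType} d (T : measurableType d) (P : probability T R).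
Context (C : finType) (gap : C -> nat -> {RV P >-> R}).
Hypothesis clocks : independent_poisson_clocks gap.
Context (S : eqType) (step : C -> S -> S) (s0 : S).
Context (m : nat) (k : 'I_m -> C) (E : 'I_m -> pred S) (rank : S -> nat) (bound : nat).
Hypothesis ent : forall i, entered_by step s0 (k i) (E i) rank bound.

Let U i w := last_change_time step s0 (gaps_of gap w) (k i).

Let mU i : measurable_fun setT (U i).
Proof. exact: measurable_last_change_time. Qed.

Lemma laterE t0 t ks : later gap step s0 k t0 (increments t0 t ks) =
  [set w | forall i, i \in ks -> U i w < t i].
Proof.
elim: ks t0 => [|i ks IH] t0 /=; first by apply/seteqP; split.
rewrite addrC subrK IH; apply/seteqP; split => w /=.
  by move=> [Ui Uks] j; rewrite inE => /predU1P[->|/Uks].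
by move=> H; split=> [|j jks]; apply: H; rewrite inE ?eqxx// jks orbT.
Qed.

Definition below (t : 'I_m -> R) := [set w | forall i, U i w < t i].

Lemma measurable_below t : measurable (below t).
Proof.
have -> : below t = later gap step s0 k 0 (increments 0 t (enum 'I_m)).
  by rewrite laterE; apply/seteqP; split => w H i; [move=> _|]; apply: H; rewrite mem_enum.
exact: (measurable_later mU).
Qed.

Let ks (t : 'I_m -> R) := sort (fun i j => t i <= t j) (enum 'I_m).

(** Testing the conditions in increasing order of the thresholds makes all waiting times
    nonnegative. The order depends on t alone, so it is the same for both processes. *)
Lemma below_pos (t : 'I_m -> R) : (forall i, 0 <= t i) ->
  {in increments 0 t (ks t), forall x, 0 <= x.1} /\
  fine (P (below t)) = value step E (increments 0 t (ks t)) s0.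
Proof.
move=> t0.
have ev0 : {in increments 0 t (ks t), forall x, 0 <= x.1}.
  apply: increments_ge0; rewrite path_sortedE; last exact: le_trans.
  rewrite sorted_map sort_sorted ?andbT; last by move=> i j; exact: le_total.
  by apply/allP => _ /mapP[i _ ->].
split=> //; rewrite -(last_change_law clocks ent mU ev0) laterE; congr (fine (P _)).
by apply/seteqP; split => w H i; [move=> _|]; apply: H; rewrite mem_sort mem_enum.
Qed.

(** The semigroup has no negative times, so the event is compared with [U i < 0], whose probability
    is the indicator of [E i] at the initial state. *)
Lemma below_neg (t : 'I_m -> R) i : t i < 0 -> P (below t) = 0%E.
Proof.
move=> ti; apply/eqP; rewrite -measure_le0.
have ev0 : {in [:: (0 : R, i)], forall x, 0 <= x.1} by move=> x; rewrite inE => /eqP ->.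
have := last_change_law clocks ent mU ev0.
rewrite /= flow0 mulr1 (negPf (entered_init (ent i))) => H.
have mL : measurable (later gap step s0 k 0 [:: (0 : R, i)]) by exact: (measurable_later mU).
have -> : 0%E = P (later gap step s0 k 0 [:: (0 : R, i)]).
  by apply/esym; rewrite -(fineK (fin_num_measure P _ mL)) H.
rewrite le_measure ?inE//; first exact: measurable_below.
by move=> w Uw /=; split => //; rewrite addr0; exact: lt_trans (Uw i) ti.
Qed.

End boxes.

Section tuple_law.
Context {R : realType} d1 d2 (T1 : measurableType d1) (T2 : measurableType d2).
Context (P1 : probability T1 R) (P2 : probability T2 R) (m : nat).

Definition box_below (t : 'I_m -> R) : set (m.-tuple R) :=
  [set x | forall i, tnth x i < t i].

(** The strict lower orthants form a pi-system that generates the product sigma-algebra and exhausts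
    the space, so they determine a finite measure. *)
Lemma same_distribution_below (X : T1 -> m.-tuple R) (Y : T2 -> m.-tuple R) :
  (forall i, measurable_fun setT (fun w => tnth (X w) i)) ->
  (forall i, measurable_fun setT (fun w => tnth (Y w) i)) ->
  (forall t, P1 (X @^-1` box_below t) = P2 (Y @^-1` box_below t)) ->
  same_distribution P1 P2 X Y.
Proof.
move=> mX' mY' XY.
have mX : measurable_fun setT X by apply/measurable_fun_tnthP.
have mY : measurable_fun setT Y by apply/measurable_fun_tnthP.
split => // A mA.
pose X' := mfun_Sub (mem_set mX : X \in mfun).
pose Y' := mfun_Sub (mem_set mY : Y \in mfun).
pose m1 := [the measure _ _ of distribution P1 X'].
pose m2 := [the measure _ _ of distribution P2 Y'].
suff : m1 A = m2 A by [].
pose G := range box_below; pose GT := g_sigma_algebraType G.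
have boxE t : box_below t = \bigcap_(i in [set: 'I_m]) ((@tnth m R)^~ i @^-1` `]-oo, t i[).
  apply/seteqP; split => x H i; first by move=> _; rewrite /= in_itv; exact: H.
  by have := H i I; rewrite /= in_itv.
have mbox t : measurable (box_below t).
  rewrite boxE; apply: fin_bigcap_measurable => // i _.
  by rewrite -[X in measurable X]setTI; apply: measurable_tnth.
have box_cover (x : m.-tuple R) : exists n : nat, forall i, tnth x i < n%:R.
  exists (\max_i (Num.trunc (tnth x i)).+1) => i.
  apply: lt_le_trans (truncnS_gt _) _; rewrite ler_nat.
  exact: (leq_bigmax (F := fun i => (Num.trunc (tnth x i)).+1)).
have id_measurable : measurable_fun setT (id : GT -> m.-tuple R).
  apply/measurable_fun_tnthP => i.
  apply: (measurability _ (RGenInftyO.measurableE R)) => _ [_ [a ->] <-].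
  (* A half-space in coordinate i is the union over n of the orthants whose other thresholds are
     n. *)
  have -> : setT `&` ((@tnth m R)^~ i \o id) @^-1` `]-oo, a[ =
      \bigcup_n (box_below (fun j => if j == i then a else n%:R) : set GT).
    rewrite setTI; apply/seteqP; split => x /=.
      rewrite in_itv/= => xa; have [n xn] := box_cover x; exists n => // j.
      by case: eqP => [->|].
    by move=> [n _ /(_ i)]; rewrite eqxx in_itv.
  by apply: bigcupT_measurable => n; apply: sub_sigma_algebra; exists (fun j => if j == i then a else n%:R).
have GA : <<s G >> A by rewrite -[A]setTI; exact: id_measurable.
apply: (@g_sigma_algebra_measure_unique _ _ _ G _ (fun n => box_below (fun=> n%:R))) GA.
- by move=> _ [t _ <-]; exact: mbox.
- by move=> n; exists (fun=> n%:R).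
- apply/seteqP; split => // x _; have [n xn] := box_cover x; by exists n.
- move=> _ _ [t _ <-] [u _ <-]; exists (fun i => Num.min (t i) (u i)) => //.
  apply/seteqP; split => x H; last by case: H => Ht Hu i; rewrite lt_min Ht Hu.
  by split => i; have := H i; rewrite lt_min => /andP[].
- by move=> _ [t _ <-]; exact: XY.
- by move=> n; rewrite ltey_eq fin_num_measure.
Qed.

End tuple_law.

Theorem theorem4 (R : realType) (n : nat) (hn : (2 <= n <= 6)%N)
    (d1 d2 : measure_display)
    (T1 : measurableType d1) (T2 : measurableType d2)
    (P1 : probability T1 R) (P2 : probability T2 R)
    (swap_gap : 'I_n.-1 -> nat -> {RV P1 >-> R})
    (box_gap : staircase_box n -> nat -> {RV P2 >-> R})
    (hswap : independent_poisson_clocks swap_gap)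
    (hbox : independent_poisson_clocks box_gap) :
  same_distribution P1 P2
    (fun w : T1 => last_swap_times (fun k m => swap_gap k m w))
    (fun w : T2 => corner_addition_times (fun b m => box_gap b m w)).
Proof.
apply: same_distribution_below.
- move=> i; under eq_fun do rewrite tnth_mktuple.
  exact: measurable_last_change_time.
- move=> i; under eq_fun do rewrite tnth_mktuple.
  exact: measurable_last_change_time.
move=> t.
have -> : (fun w => last_swap_times (fun k m => swap_gap k m w)) @^-1` box_below t =
    below swap_gap (@swap_step n) 1%g id t.
  by apply/seteqP; split => w H i; have := H i; rewrite tnth_mktuple.
have -> : (fun w => corner_addition_times (fun b m => box_gap b m w)) @^-1` box_below t =
    below box_gap (@growth_step n) finset.set0 (@corner n) t.
  by apply/seteqP; split => w H i; have := H i; rewrite tnth_mktuple.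
have ent1 := @swap_entered n; have ent2 := @growth_entered n.
have [/forallP t0|] := boolP [forall i, 0 <= t i]; last first.
  rewrite negb_forall => /existsP[i]; rewrite -ltNge => ti.
  by rewrite (below_neg hswap ent1 ti) (below_neg hbox ent2 ti).
have [ev0 V1] := below_pos hswap ent1 t0; have [_ V2] := below_pos hbox ent2 t0.
rewrite -(fineK (fin_num_measure P1 _ (measurable_below swap_gap _ _ _ t))).
rewrite -(fineK (fin_num_measure P2 _ (measurable_below box_gap _ _ _ t))).
by rewrite V1 V2 (swap_growth_value hn ev0).
Qed.
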